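(* Let $\nu$ be the self-similar measure associated with a family $(g_i)_{i=1}^M$ of contractive similitudes of $\mathbb{R}^q$ (contraction ratios $c_i\in(0,1)$) satisfying the open set condition and a probability vector $(t_i)_{i=1}^M$. Let $(f_i)_{i=1}^N$ be contractive similitudes of $\mathbb{R}^q$ and $(p_i)_{i=0}^N$ a probability vector with all $p_i>0$, such that the condensation system $((f_i)_{i=1}^N,(p_i)_{i=0}^N,\nu)$ satisfies the in-homogeneous open set condition (IOSC), and let $\mu$ be the unique Borel probability measure with $\mu=p_0\nu+\sum_{i=1}^Np_i\,\mu\circ f_i^{-1}$. For $r>0$ let $s_r>0$ be given by $\sum_{i=1}^M(t_ic_i^r)^{\frac{s_r}{s_r+r}}=1$. Then there exists some $r_0>0$ such that, for all $r\in(0,r_0)$, $$D_r(\mu)=D_r(\nu)=s_r\quad\text{and}\quad 0<\underline{Q}_r^{s_r}(\mu)\le\overline{Q}_r^{s_r}(\mu)<\infty.$$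
   Context: Here $M,N\ge 2$ and $t_i>0$ for all $i$. A family $(h_i)_{i=1}^m$ of contractive similitudes satisfies the open set condition (OSC) if there is a bounded non-empty open set $O$ with $h_i(O)\subset O$ for all $i$ and $h_i(O)\cap h_j(O)=\emptyset$ for $i\ne j$. The self-similar set of $(h_i)$ is the unique non-empty compact set $F$ with $F=\bigcup_i h_i(F)$; the self-similar measure associated with $(h_i)$ and a probability vector $(q_i)$ is the unique Borel probability measure $P$ with $P=\sum_i q_iP\circ h_i^{-1}$. $E$ denotes the self-similar set of $(f_i)_{i=1}^N$ and $C={\rm supp}(\nu)$, the self-similar set of $(g_i)_{i=1}^M$. IOSC: there is a bounded non-empty open set $U\subset\mathbb{R}^q$ such that (A1) $f_i(U)\subset U$ for all $1\le i\le N$; (A2) $f_i(U)$, $1\le i\le N$, are pairwise disjoint; (A3) $E\cap U\ne\emptyset$ and $C\subset U$; (A4) $\nu(\partial U)=0$ and $C\cap f_i({\rm cl}(U))=\emptyset$ for all $1\le i\le N$. For a Borel probability measure $P$ on $\mathbb{R}^q$: $e_{n,r}(P):=\inf_{\alpha}\big(\int d(x,\alpha)^r\,dP(x)\big)^{1/r}$, the infimum over all $\alpha\subset\mathbb{R}^q$ with $1\le{\rm card}(\alpha)\le n$. The quantization dimension $D_r(P)$ is the limit $\lim_{n\to\infty}\frac{\log n}{-\log e_{n,r}(P)}$ (when it exists; the asserted equalities include existence). For $s>0$: $\overline{Q}_r^s(P):=\limsup_{n\to\infty}n^{1/s}e_{n,r}(P)$ and $\underline{Q}_r^s(P):=\liminf_{n\to\infty}n^{1/s}e_{n,r}(P)$.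 *)

(* Defs.v *)
From HB Require Import structures.
From mathcomp Require Import all_boot all_order all_algebra.
From mathcomp Require Import all_classical all_reals all_analysis.

Set Implicit Arguments.
Unset Strict Implicit.
Unset Printing Implicit Defensive.

Import Order.TTheory GRing.Theory Num.Theory.
Import numFieldNormedType.Exports.

Local Open Scope classical_set_scope.
Local Open Scope ring_scope.

(* R^q is 'rV[R]_q. The library norm on it is the sup norm; it induces the
   usual topology and bounded sets, but similitudes and d(x, alpha) are metric
   notions and use [eucl_dist]. *)
Definition eucl_dist (R : realType) (q : nat) (x y : 'rV[R]_q) : R :=
  Num.sqrt (\sum_(k < q) (x 0 k - y 0 k) ^+ 2).

Definition dist_to (R : realType) (q : nat) (x : 'rV[R]_q)
    (alpha : set 'rV[R]_q) : R :=
  inf [set eucl_dist x a | a in alpha].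

Definition borel (R : realType) (q : nat) :=
  g_sigma_algebraType (@open 'rV[R]_q).

Definition boundary (T : topologicalType) (U : set T) : set T :=
  closure U `\` interior U.

Definition msupport (R : realType) (q : nat) (P : probability (borel R q) R)
    : set 'rV[R]_q :=
  [set x | forall V : set 'rV[R]_q, open V -> V x -> (0 < P V)%E].

Definition contractive_similitude (R : realType) (q : nat) (c : R)
    (h : 'rV[R]_q -> 'rV[R]_q) : Prop :=
  0 < c < 1 /\ forall x y, eucl_dist (h x) (h y) = c * eucl_dist x y.

Definition osc_set (R : realType) (q m : nat)
    (h : 'I_m -> 'rV[R]_q -> 'rV[R]_q) (O : set 'rV[R]_q) : Prop :=
  [/\ bounded_set O, O !=set0, open O,
      forall i, h i @` O `<=` O
    & trivIset setT (fun i => h i @` O)].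

Definition open_set_condition (R : realType) (q m : nat)
    (h : 'I_m -> 'rV[R]_q -> 'rV[R]_q) : Prop :=
  exists O, osc_set h O.

Definition self_similar_set (R : realType) (q m : nat)
    (h : 'I_m -> 'rV[R]_q -> 'rV[R]_q) (F : set 'rV[R]_q) : Prop :=
  [/\ F !=set0, compact F & F = \bigcup_(i in setT) (h i @` F)].

Definition self_similar_measure (R : realType) (q m : nat)
    (h : 'I_m -> 'rV[R]_q -> 'rV[R]_q) (w : 'I_m -> R)
    (P : probability (borel R q) R) : Prop :=
  forall A : set (borel R q), measurable A ->
    (P A = \sum_(i < m) (w i)%:E * P (h i @^-1` A))%E.

(* The weight p_0 of nu is [p ord0]; the weight p_i of f_i, 1 <= i <= N, is
   [p (lift ord0 i)], with i : 'I_N counted from 0. *)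
Definition condensation_measure (R : realType) (q N : nat)
    (f : 'I_N -> 'rV[R]_q -> 'rV[R]_q) (p : 'I_N.+1 -> R)
    (nu mu : probability (borel R q) R) : Prop :=
  forall A : set (borel R q), measurable A ->
    (mu A = (p ord0)%:E * nu A
            + \sum_(i < N) (p (lift ord0 i))%:E * mu (f i @^-1` A))%E.

(* E is meant to be the self-similar set of f. *)
Definition in_homogeneous_osc (R : realType) (q N : nat)
    (f : 'I_N -> 'rV[R]_q -> 'rV[R]_q) (E : set 'rV[R]_q)
    (nu : probability (borel R q) R) : Prop :=
  exists U : set 'rV[R]_q,
    [/\ osc_set f U,
        E `&` U !=set0 /\ msupport nu `<=` U,
        nu (boundary U) = 0%E
      & forall i, msupport nu `&` (f i @` closure U) = set0].

Definition quantization_error (R : realType) (q : nat)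
    (P : probability (borel R q) R) (r : R) (n : nat) : \bar R :=
  ereal_inf [set (poweR (\int[P]_x (dist_to x alpha `^ r)%:E) r^-1)%E
            | alpha in [set alpha : set 'rV[R]_q |
                         alpha !=set0 /\ (alpha #<= `I_n)%card]].

(* Since ln 0 = 0, 0^-1 = 0 and fine +oo = 0, the quotient is 0 when
   e_{n,r}(P) is 0 or +oo, in accordance with log 0 = -oo, log +oo = +oo. *)
Definition is_quantization_dimension (R : realType) (q : nat)
    (P : probability (borel R q) R) (r D : R) : Prop :=
  ((fun n : nat => ln n%:R / - ln (fine (quantization_error P r n)))
     @ \oo --> D).

Definition upper_quantization_coef (R : realType) (q : nat)
    (P : probability (borel R q) R) (r s : R) : \bar R :=
  limn_esup (fun n : nat => ((n%:R `^ s^-1)%:E * quantization_error P r n)%E).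

Definition lower_quantization_coef (R : realType) (q : nat)
    (P : probability (borel R q) R) (r s : R) : \bar R :=
  limn_einf (fun n : nat => ((n%:R `^ s^-1)%:E * quantization_error P r n)%E).

(* Main.v *)
Require Import Defs.
From HB Require Import structures.
From mathcomp Require Import all_boot all_order all_algebra.
From mathcomp Require Import all_classical all_reals all_analysis.
From mathcomp Require Import measurable_realfun lra ring.

Import Order.TTheory GRing.Theory Num.Theory.
Import numFieldNormedType.Exports.

Local Open Scope classical_set_scope.
Local Open Scope ring_scope.

(** Fix r > 0, put rho = r / s_r and theta = s_r / (s_r + r), so that
    theta (1 + rho) = 1, and let w_i = (t_i c_i^r)^theta. Then (w_i) is a
    probability vector with t_i c_i^r = w_i^(1 + rho). Call distortion of a
    codebook alpha the integral of d(x, alpha)^r. The theorem says that the least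
    distortion over n points is comparable to n^(- rho), for mu and for nu. Since
    mu >= p_0 nu, an upper bound for mu and a lower bound for nu are all that is
    needed; the upper bound for mu is itself built on the one for nu.

    Upper bounds. If S_i are codebooks for nu with distortions d_i, the union of
    the g_i(S_i) has distortion at most the sum of the w_i^(1 + rho) d_i. Giving
    the i-th piece a budget x w_i out of a budget x reproduces a bound of the form
    D x^(- rho), because the w_i sum to 1 ([cover_recursion],
    [self_similar_covers]). For mu the weights are v_i = (p_i a_i^r)^theta and
    there is an additional term p_0 nu; the same recursion closes as soon as the
    v_i sum to less than 1 ([condensation_covers]). This is where r must be small:
    theta tends to 1 as r tends to 0, because otherwise the sum of the w_i would
    exceed 1, and at theta = 1, r = 0 the v_i sum to 1 - p_0
    ([small_order_exponent]).

    Lower bound. By an argument of Schief, the open set condition provides a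
    word u such that the pieces g_(s u) of nu, for s in any antichain of words,
    are far apart in comparison with their own size ([separated_tails]). One point
    of a codebook can then serve at most one of them. In an antichain of at least
    2 n words with all w_s of order 1 / n ([stopping_words]), at least n pieces are
    not served by a codebook of n points, and each of them contributes a multiple
    of t_s c_s^r = w_s^(1 + rho), that is of n^(- 1 - rho)
    ([self_similar_distortion_lower]).

    All integrals are finite because both measures live on a ball, the maps being
    contractions ([bounded_support]). *)

(** * Euclidean distance and similitudes *)

(** The Cauchy-Schwarz inequality: the squares (B u_k - S v_k)^2 add up to
    B (A B - S^2), with S the inner product and A, B the squared norms. *)
Lemma sum_mul_sqr_le {R : realType} {q : nat} (u v : 'I_q -> R) :
  (\sum_k u k * v k) ^+ 2 <= (\sum_k u k ^+ 2) * (\sum_k v k ^+ 2).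
Proof.
set S := \sum_k u k * v k; set A := \sum_k u k ^+ 2; set B := \sum_k v k ^+ 2.
have B0 : 0 <= B by apply: sumr_ge0 => k _; exact: sqr_ge0.
have [B1|] := ltP 0 B; last first.
  move=> B1; have /eqP/psumr_eq0P vk0 : B == 0 by rewrite eq_le B0 B1.
  have S0 : S = 0.
    rewrite /S big1// => k _.
    have /eqP := vk0 (fun k _ => sqr_ge0 (v k)) k isT.
    by rewrite sqrf_eq0 => /eqP ->; rewrite mulr0.
  by rewrite S0 expr0n/= mulr_ge0// sumr_ge0// => k _; exact: sqr_ge0.
have : 0 <= \sum_k (B * u k - S * v k) ^+ 2.
  by apply: sumr_ge0 => k _; exact: sqr_ge0.
have -> : \sum_k (B * u k - S * v k) ^+ 2 = B * (A * B - S ^+ 2).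
  transitivity (\sum_k (B ^+ 2 * (u k ^+ 2) - B * S *+ 2 * (u k * v k)
                        + S ^+ 2 * (v k ^+ 2))).
    by apply: eq_bigr => k _; ring.
  rewrite big_split/= sumrB -!mulr_sumr -/A -/B -/S; ring.
by rewrite pmulr_rge0// subr_ge0.
Qed.

Lemma eucl_dist_ge0 {R : realType} {q : nat} (x y : 'rV[R]_q) :
  0 <= eucl_dist x y.
Proof. exact: sqrtr_ge0. Qed.

Lemma eucl_dist_sqr {R : realType} {q : nat} (x y : 'rV[R]_q) :
  eucl_dist x y ^+ 2 = \sum_k (x 0 k - y 0 k) ^+ 2.
Proof. by rewrite sqr_sqrtr// sumr_ge0// => k _; exact: sqr_ge0. Qed.

Lemma eucl_distC {R : realType} {q : nat} (x y : 'rV[R]_q) :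
  eucl_dist x y = eucl_dist y x.
Proof.
by congr Num.sqrt; apply: eq_bigr => k _; rewrite -sqrrN opprB.
Qed.

Lemma eucl_distxx {R : realType} {q : nat} (x : 'rV[R]_q) : eucl_dist x x = 0.
Proof.
by rewrite /eucl_dist big1 ?sqrtr0// => k _; rewrite subrr expr0n.
Qed.

Lemma eucl_dist_triangle {R : realType} {q : nat} (y x z : 'rV[R]_q) :
  eucl_dist x z <= eucl_dist x y + eucl_dist y z.
Proof.
rewrite -ler_sqr ?nnegrE ?addr_ge0 ?eucl_dist_ge0//.
have -> : eucl_dist x z ^+ 2 = eucl_dist x y ^+ 2 + eucl_dist y z ^+ 2
    + (\sum_k (x 0 k - y 0 k) * (y 0 k - z 0 k)) *+ 2.
  rewrite !eucl_dist_sqr -big_split -sumrMnl -big_split/=.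
  by apply: eq_bigr => k _; ring.
rewrite sqrrD addrAC lerD2r lerD2l lerMn2r/=.
apply: le_trans (ler_norm _) _.
rewrite -ler_sqr ?nnegrE ?mulr_ge0 ?eucl_dist_ge0// real_normK ?num_real//.
by rewrite exprMn !eucl_dist_sqr; exact: sum_mul_sqr_le.
Qed.

Lemma coord_le_eucl_dist {R : realType} {q : nat} (x y : 'rV[R]_q) (k : 'I_q) :
  `|x 0 k - y 0 k| <= eucl_dist x y.
Proof.
rewrite -sqrtr_sqr ler_wsqrtr//.
by rewrite (bigD1 k)//= lerDl sumr_ge0// => i _; exact: sqr_ge0.
Qed.

(** Lossy comparison, with q in place of the square root of q; the constant is
    immaterial for topology and for counting arguments. *)
Lemma eucl_dist_le_coord {R : realType} {q : nat} (x y : 'rV[R]_q) (h : R) :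
  (forall k, `|x 0 k - y 0 k| <= h) -> eucl_dist x y <= q%:R * `|h|.
Proof.
move=> xyh; case: (ltnP 0 q) => [q0|]; last first.
  by rewrite leqn0 => /eqP q0; subst q; rewrite /eucl_dist big_ord0 sqrtr0 mul0r.
rewrite -(ger0_norm (mulr_ge0 (ler0n R q) (normr_ge0 h))) -sqrtr_sqr ler_wsqrtr//.
apply: (@le_trans _ _ (\sum_(k < q) `|h| ^+ 2)).
  apply: ler_sum => k _; rewrite -[leLHS]real_normK ?num_real//.
  by rewrite lerXn2r// ?nnegrE// (le_trans (xyh k))// ler_norm.
rewrite sumr_const card_ord exprMn -[in leLHS]mulr_natl ler_wpM2r ?sqr_ge0//.
by rewrite -natrX ler_nat -mulnn leq_pmulr.
Qed.

Lemma norm_le_eucl_dist {R : realType} {q : nat} (x y : 'rV[R]_q) :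
  `|x - y| <= eucl_dist x y.
Proof.
rewrite [leLHS]/Num.norm /= mx_normrE; apply/bigmax_leP; split => [|[i k] _].
  exact: eucl_dist_ge0.
by rewrite /= ord1 !mxE; exact: coord_le_eucl_dist.
Qed.

Lemma eucl_dist_le_norm {R : realType} {q : nat} (x y : 'rV[R]_q) :
  eucl_dist x y <= q%:R * `|x - y|.
Proof.
rewrite -[X in _ * X]normr_id; apply: eucl_dist_le_coord => k.
have /mapP[j Hj ->] : `|x 0 k - y 0 k| \in [seq `|(x - y) i.1 i.2| | i : 'I_1 * 'I_q].
  by apply/mapP; exists (ord0, k); rewrite ?mem_enum//= !mxE.
by rewrite [leRHS]/Num.norm /= mx_normrE; apply/bigmax_geP; right => /=; exists j.
Qed.

Lemma eucl_lipschitz_continuous {R : realType} {q : nat} {V : normedModType R}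
    (K : R) (phi : 'rV[R]_q -> V) :
  (forall x y, `|phi x - phi y| <= K * eucl_dist x y) -> continuous phi.
Proof.
move=> lip x; apply/(@cvgrPdist_le _ _ _ (nbhs x) (nbhs_filter x)) => e e0.
have d0 : 0 < e / (`|K| * q%:R + 1).
  by rewrite divr_gt0// ltr_wpDl// mulr_ge0.
apply: (@filterS _ (nbhs x) (nbhs_filter x)) (nbhsx_ballx x _ d0) => z.
rewrite -ball_normE/= => xz; apply: le_trans (lip x z) _.
apply: (@le_trans _ _ (`|K| * (q%:R * `|x - z|))).
  apply: (@le_trans _ _ (`|K| * eucl_dist x z)).
    by rewrite ler_wpM2r ?eucl_dist_ge0// ler_norm.
  by rewrite ler_wpM2l// eucl_dist_le_norm.
rewrite mulrA; apply: (@le_trans _ _ ((`|K| * q%:R + 1) * `|x - z|)).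
  by rewrite ler_wpM2r// lerDl.
by rewrite mulrC -ler_pdivlMr ?ltW// ltr_wpDl// mulr_ge0.
Qed.

Lemma open_eucl_ball {R : realType} {q : nat} {O : set 'rV[R]_q} {y : 'rV[R]_q} :
  open O -> O y -> exists2 d : R, 0 < d & forall x, eucl_dist y x < d -> O x.
Proof.
move=> oO Oy; have := open_nbhs_nbhs (conj oO Oy).
move=> /nbhs_ballP[d /= d0 dO]; exists d => // x yx; apply: dO.
by rewrite -ball_normE/=; exact: le_lt_trans (norm_le_eucl_dist _ _) yx.
Qed.

Lemma bounded_eucl_dist {R : realType} {q : nat} {O : set 'rV[R]_q} :
  bounded_set O -> exists2 D : R, 0 < D & forall x y, O x -> O y -> eucl_dist x y <= D.
Proof.
move=> [B0 [_ /(_ (B0 + 1))]]; rewrite ltrDl => /(_ ltr01).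
set B := B0 + 1 => OB; exists (q%:R * (`|B| + `|B|) + 1).
  by rewrite ltr_wpDl// mulr_ge0// addr_ge0.
move=> x y Ox Oy; apply: le_trans (eucl_dist_le_norm x y) _.
rewrite (@le_trans _ _ (q%:R * (`|B| + `|B|)))// ?lerDl//.
rewrite ler_wpM2l//; apply: le_trans (ler_normB _ _) _.
by apply: lerD; (apply: le_trans (ler_norm B)); apply: OB.
Qed.

(** Polarization makes L = h - h(0) preserve inner products up to the factor c^2,
    so the images under L of the canonical basis are the rows of a matrix A with
    A A^T = c^2. Hence A is invertible, and a vector is determined by its inner
    products with the rows; for x = c^(-2) (y - h(0)) A^T those of L x and of
    y - h(0) agree. *)
Lemma similitude_surjective {R : realType} {q : nat} {c : R}
    {h : 'rV[R]_q -> 'rV[R]_q} :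
  contractive_similitude c h -> forall y, exists x, h x = y.
Proof.
move=> [/andP[c0 _] hc] y.
pose L x := h x - h 0; pose dot (u v : 'rV[R]_q) := \sum_k u 0 k * v 0 k.
have polar u v : dot u v *+ 2 = dot u u + dot v v - eucl_dist u v ^+ 2.
  rewrite eucl_dist_sqr -sumrMnl -big_split -sumrB/=.
  by apply: eq_bigr => k _; ring.
have sqrE u : dot u u = eucl_dist u 0 ^+ 2.
  by rewrite eucl_dist_sqr; apply: eq_bigr => k _; rewrite mxE subr0 expr2.
have distL u v : eucl_dist (L u) (L v) = c * eucl_dist u v.
  rewrite -hc; congr Num.sqrt; apply: eq_bigr => k _; rewrite !mxE.
  by rewrite opprB addrA subrK.
have L0 : L 0 = 0 by rewrite /L subrr.
have dotL u v : dot (L u) (L v) = c ^+ 2 * dot u v.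
  apply: (@mulIf _ 2) => //; rewrite -!mulrA !mulr_natr !polar !sqrE -L0 !distL L0.
  by ring.
pose A := \matrix_(i < q, j < q) L (delta_mx 0 i) 0 j.
have cV : c ^- 2 * c ^+ 2 = 1 by rewrite mulVf// expf_neq0// gt_eqF.
have AAT : A *m (c ^- 2 *: A^T) = 1%:M.
  apply/matrixP => i j; rewrite -scalemxAr !mxE.
  have -> : \sum_k A i k * A^T k j = dot (L (delta_mx 0 i)) (L (delta_mx 0 j)).
    by apply: eq_bigr => k _; rewrite !mxE.
  rewrite dotL mulrA cV mul1r /dot (bigD1 i)//= big1 => [|k ki].
    by rewrite !mxE !eqxx mul1r addr0.
  by rewrite !mxE (negPf ki) andbF mul0r.
have ATA := mulmx1C AAT.
pose x := c ^- 2 *: ((y - h 0) *m A^T).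
exists x; suff : L x = y - h 0 by move/(congr1 (+%R^~ (h 0))); rewrite !subrK.
have LxA : L x *m A^T = (y - h 0) *m A^T.
  transitivity (c ^+ 2 *: x); last by rewrite /x scalerA mulrC cV scale1r.
  apply/rowP => k; rewrite !mxE.
  transitivity (dot (L x) (L (delta_mx 0 k))).
    by apply: eq_bigr => i _; rewrite !mxE.
  rewrite dotL; congr (_ * _); rewrite /dot (bigD1 k)//= big1 => [|i ik].
    by rewrite !mxE !eqxx mulr1 addr0.
  by rewrite !mxE (negPf ik) andbF mulr0.
rewrite -[LHS]mulmx1 -[RHS]mulmx1 -ATA.
by rewrite -scalemxAl -!scalemxAr !mulmxA LxA.
Qed.

(** * Distance to a set, and integrals of its powers *)

Lemma dist_to_le {R : realType} {q : nat} {alpha : set 'rV[R]_q} (x : 'rV[R]_q)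
    {a : 'rV[R]_q} :
  alpha a -> dist_to x alpha <= eucl_dist x a.
Proof.
move=> aa; apply: ge_inf; last by exists a.
by exists 0 => _ [b _ <-]; exact: eucl_dist_ge0.
Qed.

Lemma le_dist_to {R : realType} {q : nat} {alpha : set 'rV[R]_q} (x : 'rV[R]_q) (m : R) :
  alpha !=set0 -> (forall a, alpha a -> m <= eucl_dist x a) -> m <= dist_to x alpha.
Proof.
move=> [a aa] ma; apply: lb_le_inf; first by exists (eucl_dist x a), a.
by move=> _ [b ab <-]; exact: ma.
Qed.

Lemma dist_to_ge0 {R : realType} {q : nat} {alpha : set 'rV[R]_q} (x : 'rV[R]_q) :
  alpha !=set0 -> 0 <= dist_to x alpha.
Proof. by move=> a0; apply: le_dist_to => // a _; exact: eucl_dist_ge0. Qed.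

Lemma dist_to_subset {R : realType} {q : nat} {alpha beta : set 'rV[R]_q} (x : 'rV[R]_q) :
  alpha !=set0 -> alpha `<=` beta -> dist_to x beta <= dist_to x alpha.
Proof. by move=> a0 ab; apply: le_dist_to => // a /ab; exact: dist_to_le. Qed.

Lemma dist_to_lipschitz {R : realType} {q : nat} {alpha : set 'rV[R]_q} (x z : 'rV[R]_q) :
  alpha !=set0 -> dist_to x alpha <= eucl_dist x z + dist_to z alpha.
Proof.
move=> a0; rewrite -lerBlDl; apply: le_dist_to => // a aa; rewrite lerBlDl.
exact: le_trans (dist_to_le x aa) (eucl_dist_triangle _ _ _).
Qed.

Lemma dist_to_image {R : realType} {q : nat} {c : R} {h : 'rV[R]_q -> 'rV[R]_q}
    {alpha beta : set 'rV[R]_q} (x : 'rV[R]_q) :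
  contractive_similitude c h -> alpha !=set0 -> h @` alpha `<=` beta ->
  dist_to (h x) beta <= c * dist_to x alpha.
Proof.
move=> [/andP[c0 _] hc] a0 ab; rewrite -ler_pdivrMl//.
apply: le_dist_to => // a aa; rewrite ler_pdivrMl// -hc; apply: dist_to_le.
by apply: ab; exists a.
Qed.

Lemma similitude_continuous {R : realType} {q : nat} {c : R} {h : 'rV[R]_q -> 'rV[R]_q} :
  contractive_similitude c h -> continuous h.
Proof.
move=> [_ hc]; apply: (eucl_lipschitz_continuous c) => x y.
by rewrite -hc; exact: norm_le_eucl_dist.
Qed.

Lemma open_borel_measurable {R : realType} {q : nat} (A : set 'rV[R]_q) :
  open A -> measurable (A : set (borel R q)).
Proof. exact: sub_sigma_algebra. Qed.

Lemma continuous_borel_measurable {R : realType} {q : nat} (h : 'rV[R]_q -> 'rV[R]_q) :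
  continuous h -> measurable_fun setT (h : borel R q -> borel R q).
Proof.
move=> /continuousP hc; apply: (@measurability _ _ (borel R q) (borel R q) setT h (@open 'rV[R]_q)) => //.
move=> _ [A oA <-]; rewrite setTI; exact: open_borel_measurable (hc _ oA).
Qed.

Lemma continuous_real_measurable {R : realType} {q : nat} (h : 'rV[R]_q -> R) :
  continuous h -> measurable_fun setT (h : borel R q -> R).
Proof.
move=> /continuousP hc; apply: (measurability _ (RGenOInfty.measurableE R)).
move=> _ [_ [a ->] <-]; rewrite setTI; apply: open_borel_measurable; exact: hc.
Qed.

Lemma eucl_dist_measurable {R : realType} {q : nat} (y : 'rV[R]_q) :
  measurable_fun [set: borel R q] (fun x => eucl_dist y x).
Proof.
apply: continuous_real_measurable; apply: (eucl_lipschitz_continuous 1) => x z.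
rewrite mul1r ler_distl; have := eucl_dist_triangle z y x.
have := eucl_dist_triangle x y z; rewrite (eucl_distC z x); lra.
Qed.

Lemma dist_to_powR_measurable {R : realType} {q : nat} (alpha : set 'rV[R]_q) (r : R) :
  alpha !=set0 ->
  measurable_fun [set: borel R q] (fun x => (dist_to x alpha `^ r)%:E).
Proof.
move=> a0; apply/measurable_EFinP.
apply: (measurableT_comp (measurable_powR r)).
apply: continuous_real_measurable; apply: (eucl_lipschitz_continuous 1) => x z.
rewrite mul1r ler_distl; have := dist_to_lipschitz z x a0.
have := dist_to_lipschitz x z a0; rewrite (eucl_distC z x); lra.
Qed.

(** The identity for measures of sets says that P is a finite sum of scaled
    image measures, and integration against such a sum is known term by term. *)
Lemma integral_mixture {R : realType} {q n : nat} (w : 'I_n -> R)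
    (P : probability (borel R q) R) (Q : 'I_n -> probability (borel R q) R)
    (h : 'I_n -> borel R q -> borel R q) (F : borel R q -> \bar R) :
  (forall i, 0 <= w i) ->
  (forall i, measurable_fun setT (h i)) ->
  (forall A, measurable A ->
    (P A = \sum_(i < n) (w i)%:E * Q i (h i @^-1` A))%E) ->
  measurable_fun setT F -> (forall x, 0 <= F x)%E ->
  (\int[P]_x F x = \sum_(i < n) (w i)%:E * \int[Q i]_x F (h i x))%E.
Proof.
move=> w0 mh PQ mF F0.
pose m_ (k : nat) : {measure set (borel R q) -> \bar R} :=
  if insub k is Some i then mscale (NngNum (w0 i)) (pushforward (Q i) (h i))
  else mzero.
pose m := m_ mh.
have mE (i : 'I_n) : m i = mscale (NngNum (w0 i)) (pushforward (Q i) (h i)) :> (set _ -> \bar R).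
  by rewrite /m /m_ valK.
transitivity (\int[msum m n]_x F x)%E.
  apply: eq_measure_integral => A mA _; apply: etrans (PQ A mA) _; rewrite /msum/=.
  by apply: eq_bigr => i _; rewrite mE.
rewrite ge0_integral_measure_sum//; apply: eq_bigr => i _.
by rewrite mE ge0_integral_mscale//= ge0_integral_pushforward.
Qed.

(** * Words *)

Definition word_map {R : realType} {q M : nat} (g : 'I_M -> 'rV[R]_q -> 'rV[R]_q)
  (s : seq 'I_M) : 'rV[R]_q -> 'rV[R]_q := foldr (fun i h => g i \o h) id s.

Definition word_prod {R : realType} {M : nat} (c : 'I_M -> R) (s : seq 'I_M) : R :=
  \prod_(i <- s) c i.

Definition incomparable {M : nat} (s1 s2 : seq 'I_M) : bool :=
  ~~ prefix s1 s2 && ~~ prefix s2 s1.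

Lemma incomparableC {M : nat} (s1 s2 : seq 'I_M) :
  incomparable s1 s2 = incomparable s2 s1.
Proof. exact: andbC. Qed.

Lemma incomparable_cat {M : nat} (s s1 s2 : seq 'I_M) :
  incomparable (s ++ s1) (s ++ s2) = incomparable s1 s2.
Proof. by rewrite /incomparable !prefix_catr// eqxx. Qed.

Lemma prefix_comparable {M : nat} {s1 s2 s : seq 'I_M} :
  prefix s1 s -> prefix s2 s -> ~~ incomparable s1 s2.
Proof.
elim: s s1 s2 => [|i s IH] [|i1 s1] [|i2 s2]//=.
rewrite /incomparable !prefix_cons => /andP[/eqP -> p1] /andP[/eqP -> p2].
by rewrite eqxx/=; exact: IH.
Qed.

Lemma word_map_cat {R : realType} {q M : nat} (g : 'I_M -> 'rV[R]_q -> 'rV[R]_q)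
    (s1 s2 : seq 'I_M) x :
  word_map g (s1 ++ s2) x = word_map g s1 (word_map g s2 x).
Proof. by elim: s1 => //= i s1 ->. Qed.

Lemma word_prod_cat {R : realType} {M : nat} (c : 'I_M -> R) (s1 s2 : seq 'I_M) :
  word_prod c (s1 ++ s2) = word_prod c s1 * word_prod c s2.
Proof. exact: big_cat. Qed.

Lemma word_prod_cons {R : realType} {M : nat} (c : 'I_M -> R) i (s : seq 'I_M) :
  word_prod c (i :: s) = c i * word_prod c s.
Proof. exact: big_cons. Qed.

Lemma word_prod_gt0 {R : realType} {M : nat} (c : 'I_M -> R) (s : seq 'I_M) :
  (forall i, 0 < c i) -> 0 < word_prod c s.
Proof. by move=> c0; apply: prodr_gt0. Qed.

Lemma word_prod_lt1 {R : realType} {M : nat} (c : 'I_M -> R) (s : seq 'I_M) :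
  (forall i, 0 < c i < 1) -> s != [::] -> word_prod c s < 1.
Proof.
move=> c01; case: s => // i s _; have /andP[ci0 ci1] := c01 i.
rewrite word_prod_cons (le_lt_trans _ ci1)// ger_pMr//.
apply: prodr_ile1 => j _; have /andP[cj0 cj1] := c01 j.
by rewrite !ltW.
Qed.

Lemma word_prod_le1 {R : realType} {M : nat} (c : 'I_M -> R) (s : seq 'I_M) :
  (forall i, 0 < c i < 1) -> word_prod c s <= 1.
Proof.
move=> c01; have [->|s0] := eqVneq s [::]; first by rewrite /word_prod big_nil.
exact/ltW/word_prod_lt1.
Qed.

Lemma word_map_dist {R : realType} {q M : nat} {g : 'I_M -> 'rV[R]_q -> 'rV[R]_q}
    {c : 'I_M -> R} (s : seq 'I_M) x y :
  (forall i, contractive_similitude (c i) (g i)) ->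
  eucl_dist (word_map g s x) (word_map g s y) = word_prod c s * eucl_dist x y.
Proof.
move=> hg; elim: s => [|i s IH] /=; first by rewrite /word_prod big_nil mul1r.
by have [_ ->] := hg i; rewrite IH word_prod_cons mulrA.
Qed.

Lemma word_map_surjective {R : realType} {q M : nat}
    {g : 'I_M -> 'rV[R]_q -> 'rV[R]_q} {c : 'I_M -> R} (s : seq 'I_M) y :
  (forall i, contractive_similitude (c i) (g i)) -> exists x, word_map g s x = y.
Proof.
move=> hg; elim: s y => [|i s IH] y /=; first by exists y.
have [z <-] := similitude_surjective (hg i) y.
by have [x <-] := IH z; exists x.
Qed.

Lemma word_map_stable {R : realType} {q M : nat} {g : 'I_M -> 'rV[R]_q -> 'rV[R]_q}
    {O : set 'rV[R]_q} (s : seq 'I_M) x :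
  (forall i, g i @` O `<=` O) -> O x -> O (word_map g s x).
Proof.
by move=> gO Ox; elim: s => //= i s IH; apply: (gO i); exists (word_map g s x).
Qed.

(** After the common prefix is removed, two incomparable words start with
    different letters, whose images of O are disjoint. *)
Lemma osc_word_disjoint {R : realType} {q M : nat} {g : 'I_M -> 'rV[R]_q -> 'rV[R]_q}
    {c : 'I_M -> R} {O : set 'rV[R]_q} (s1 s2 : seq 'I_M) x y :
  (forall i, contractive_similitude (c i) (g i)) -> osc_set g O ->
  incomparable s1 s2 -> O x -> O y -> word_map g s1 x <> word_map g s2 y.
Proof.
move=> hg [_ _ _ gO tO]; elim: s1 s2 => [|i s1 IH] [|j s2]; try by case/andP.
move=> inc Ox Oy /= eqg; have [ij|ij] := eqVneq i j.
  subst j; apply: (IH s2) => //.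
    by move: inc; rewrite /incomparable !prefix_cons eqxx.
  have [/andP[ci0 _] /(_ (word_map g s1 x) (word_map g s2 y))] := hg i.
  rewrite eqg eucl_distxx => /esym/eqP; rewrite mulf_eq0 gt_eqF//= => /eqP d0.
  apply/eqP; rewrite -subr_eq0 -normr_eq0 eq_le normr_ge0 andbT -d0.
  exact: norm_le_eucl_dist.
move/trivIsetP: tO => /(_ i j I I ij); apply/eqP/set0P.
exists (g i (word_map g s1 x)); split.
  by exists (word_map g s1 x) => //; exact: word_map_stable.
by rewrite eqg; exists (word_map g s2 y) => //; exact: word_map_stable.
Qed.

(** * Separated tails under the open set condition *)

Lemma fin_pos_lbound {R : realType} {n : nat} (v : 'I_n -> R) :
  (forall i, 0 < v i) -> exists2 m, 0 < m <= 1 & forall i, m <= v i.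
Proof.
move=> v0; exists (\big[Num.min/1]_i v i); last by move=> i; exact: bigmin_le.
by rewrite bigmin_le_id andbT; apply/lt_bigmin.
Qed.

Lemma fin_lt1_ubound {R : realType} {n : nat} (v : 'I_n -> R) :
  (forall i, v i < 1) -> exists2 m, 0 < m < 1 & forall i, v i <= m.
Proof.
move=> v1; have [|m /andP[m0 m1] mv] := fin_pos_lbound (fun i => 1 - v i).
  by move=> i; rewrite subr_gt0.
exists (1 - m / 2); first by apply/andP; split; lra.
by move=> i; have := mv i; lra.
Qed.

(** Pigeonhole on a grid of mesh h rho: two points in one cell are at distance
    at most q h rho < eta rho. The bound does not depend on the scale rho, which
    is what [separated_tails] needs. *)
Lemma packing_bound {R : realType} {q : nat} (A eta : R) : 0 < eta ->
  exists n : nat, forall (rho : R) (z0 : 'rV[R]_q) (Z : seq 'rV[R]_q), 0 < rho ->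
    (forall z, z \in Z -> eucl_dist z z0 <= A * rho) ->
    pairwise (fun x y => eta * rho <= eucl_dist x y) Z -> (size Z <= n)%N.
Proof.
move=> eta0; pose h := eta / q.+1%:R; pose K := Num.truncn (2 * A / h).
have h0 : 0 < h by rewrite divr_gt0.
exists #|{: {ffun 'I_q -> 'I_K.+1}}| => rho z0 Z rho0 Zz0 Zpw.
pose u (x : 'rV[R]_q) k := (x 0 k - z0 0 k + A * rho) / (h * rho).
pose cell (x : 'rV[R]_q) := [ffun k : 'I_q => inord (Num.truncn (u x k)) : 'I_K.+1].
have hr0 : 0 < h * rho by exact: mulr_gt0.
have u0 x k : x \in Z -> 0 <= u x k.
  move=> xZ; rewrite divr_ge0 ?(ltW hr0)//.
  have := le_trans (coord_le_eucl_dist x z0 k) (Zz0 x xZ).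
  by rewrite ler_norml => /andP[+ _]; lra.
have cellE x k : x \in Z -> cell x k = Num.truncn (u x k) :> nat.
  move=> xZ; rewrite ffunE inordK// ltnS le_truncn//.
  rewrite /u invfM [_^-1 * _]mulrC mulrA ler_wpM2r ?invr_ge0 ?(ltW h0)//.
  rewrite ler_pdivrMr//.
  have := le_trans (coord_le_eucl_dist x z0 k) (Zz0 x xZ).
  by rewrite ler_norml => /andP[_]; lra.
have cell_far x y : x \in Z -> y \in Z -> eta * rho <= eucl_dist x y -> cell x != cell y.
  move=> xZ yZ; apply: contraTneq => cxy; rewrite -ltNge.
  apply: (@le_lt_trans _ _ (q%:R * `|h * rho|)).
    apply: eucl_dist_le_coord => k.
    have tr : Num.truncn (u x k) = Num.truncn (u y k).
      by rewrite -!cellE// cxy.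
    have /andP[x1 x2] := truncn_itv (u0 x k xZ).
    have /andP[y1 y2] := truncn_itv (u0 y k yZ).
    have -> : x 0 k - y 0 k = (u x k - u y k) * (h * rho).
      by rewrite /u; field; rewrite !gt_eqF.
    rewrite normrM (gtr0_norm hr0) -[leRHS]mul1r ler_wpM2r ?(ltW hr0)//.
    by move: x1 x2 y1 y2; rewrite tr -!natr1 ler_norml; lra.
  rewrite (gtr0_norm hr0) mulrA ltr_pM2r// /h mulrCA gtr_pMr//.
  by rewrite ltr_pdivrMr// mul1r ltr_nat.
have uZ : uniq (map cell Z).
  rewrite uniq_pairwise pairwise_map.
  apply: (@sub_in_pairwise _ (mem Z)) Zpw; last exact/allP.
  by move=> x y xZ yZ /=; exact: cell_far.
by rewrite -(size_map cell) -(card_uniqP uZ) max_card.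
Qed.

(** The products over the successive prefixes start at 1, and a letter multiplies
    them by at least cmin, so they cannot jump over the interval from cmin z to z. *)
Lemma word_prefix_at_scale {R : realType} {M : nat} {c : 'I_M -> R} {cmin z : R}
    {s : seq 'I_M} :
  0 < cmin <= 1 -> (forall i, cmin <= c i) ->
  0 < z <= 1 -> word_prod c s <= z ->
  exists2 s', prefix s' s & cmin * z <= word_prod c s' <= z.
Proof.
move=> /andP[cm0 cm1] cmin_le /andP[z0 z1].
elim/last_ind: s => [|s i IH] sz.
  by exists [::] => //; rewrite sz andbT /word_prod big_nil mulr_ile1// ltW.
have [/IH[s' ps' s'z]|zs] := leP (word_prod c s) z.
  by exists s' => //; apply: prefix_trans ps' (prefix_rcons _ _).
exists (rcons s i); rewrite ?prefix_refl// sz andbT.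
rewrite -cats1 word_prod_cat (_ : word_prod c [:: i] = c i); last exact: big_seq1.
rewrite mulrC.
by rewrite ler_pM// ltW.
Qed.

(** Schief's maximality argument. Call s near w if g_s has about the same ratio
    as g_w and moves y to a point at distance at most (A + D) times that ratio
    from g_w(y). By the open set condition and [packing_bound], an antichain of
    words near w has bounded length, so some w carries one, L, of maximal length.
    For any word s1 the family s1 L is an antichain near s1 w, also of maximal
    length. If the tail s2 w came too close to s1 w, its prefix u at the scale of
    s1 w would be near s1 w and incomparable with s1 L, contradicting
    maximality. *)
Lemma separated_tails {R : realType} {q M : nat} {g : 'I_M -> 'rV[R]_q -> 'rV[R]_q}
    {c : 'I_M -> R} {O : set 'rV[R]_q} {y : 'rV[R]_q} (A : R) :
  (forall i, contractive_similitude (c i) (g i)) -> osc_set g O -> O y ->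
  exists w, forall s1 s2, incomparable s1 s2 ->
    word_prod c (s2 ++ w) <= word_prod c (s1 ++ w) ->
    A * word_prod c (s1 ++ w)
      < eucl_dist (word_map g (s1 ++ w) y) (word_map g (s2 ++ w) y).
Proof.
move=> hg oO Oy; have [bO _ opO gO _] := oO.
have c01 i : 0 < c i < 1 by have [] := hg i.
have c0 i : 0 < c i by have /andP[] := c01 i.
have [cm cm01 cmc] := fin_pos_lbound c c0; have /andP[cm0 cm1] := cm01.
have [D D0 OD] := bounded_eucl_dist bO.
have [d d0 yd] := open_eucl_ball opO Oy.
pose near w (s : seq 'I_M) :=
  (cm * word_prod c w <= word_prod c s <= word_prod c w) &&
  (eucl_dist (word_map g s y) (word_map g w y) <= (A + D) * word_prod c w).
pose cluster w L := pairwise incomparable L && all (near w) L.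
have [gamma clusterB] : exists gamma, forall w L, cluster w L -> (size L <= gamma)%N.
  have [n packn] := @packing_bound R q (A + D) (d * cm) (mulr_gt0 d0 cm0).
  exists n => w L /andP[pwL /allP nearL].
  rewrite -(size_map (fun s => word_map g s y)).
  apply: (packn (word_prod c w) (word_map g w y)); first exact: word_prod_gt0.
    by move=> _ /mapP[s /nearL/andP[_ ?] ->].
  rewrite pairwise_map; apply: (@sub_in_pairwise _ (mem L)) pwL; last exact/allP.
  move=> s1 s2 s1L s2L /= inc; rewrite leNgt; apply/negP => close.
  have [x xE] := word_map_surjective s1 (word_map g s2 y) hg.
  apply: (@osc_word_disjoint _ _ _ _ _ _ s1 s2 x y hg oO inc) => //.
  apply: yd; rewrite -(@ltr_pM2l _ (word_prod c s1)) ?word_prod_gt0//.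
  rewrite -(word_map_dist s1 _ _ hg) xE (lt_le_trans close)// -mulrA mulrC.
  by rewrite ler_pM2r//; have /andP[/andP[]] := nearL _ s1L.
pose P n := `[< exists w L, cluster w L /\ size L = n >].
have exP : exists n, P n by exists 0%N; apply/asboolP; exists [::], [::].
have ubP n : P n -> (n <= gamma)%N.
  by move=> /asboolP[w [L [cL <-]]]; exact: clusterB cL.
case: (ex_maxnP exP ubP) => n /asboolP[w [L [/andP[pwL nL] sL]]] maxn.
exists w => s1 s2 inc le21; rewrite ltNge; apply/negP => close.
have z01 : 0 < word_prod c (s1 ++ w) <= 1.
  by rewrite word_prod_gt0//= word_prod_le1.
have /andP[z0 _] := z01.
have [u pu uz] := word_prefix_at_scale cm01 cmc z01 le21.
suff : P n.+1 by move/maxn; rewrite ltnn.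
apply/asboolP; exists (s1 ++ w), (u :: map (cat s1) L).
split; last by rewrite /= size_map sL.
(* u and s2 are both prefixes of s2 w, hence s1 cannot be a prefix of u *)
have not_pre : ~~ prefix s1 u.
  apply/negP => s1u; move: inc; apply/negP.
  exact: prefix_comparable (prefix_trans s1u pu) (prefix_prefix _ _).
rewrite /cluster pairwise_cons all_map /= -andbA; apply/and4P; split.
- apply/allP => a aL /=; apply/andP; split; last first.
    by apply: contra not_pre; exact: catl_prefix.
  apply: contra not_pre => us1a.
  have := prefix_comparable us1a (prefix_prefix s1 a).
  rewrite /incomparable negb_and !negbK => /orP[|//] /prefixP[e s1E].
  (* a proper prefix u of s1 would have a ratio larger than that of s1 w *)
  suff /eqP eE : e == [::] by rewrite s1E eE cats0 prefix_refl.
  apply: contraTT uz => e0; rewrite negb_and -!ltNge; apply/orP; right.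
  rewrite s1E -catA word_prod_cat gtr_pMr ?word_prod_gt0// word_prod_cat.
  rewrite (@le_lt_trans _ _ (word_prod c e)) ?word_prod_lt1//.
  by rewrite ger_pMr ?word_prod_gt0// word_prod_le1.
- rewrite pairwise_map; apply: sub_pairwise pwL => a b /=.
  by rewrite incomparable_cat.
- rewrite /near uz/=; apply: le_trans (eucl_dist_triangle (word_map g (s2 ++ w) y) _ _) _.
  rewrite mulrDl addrC lerD//; first by rewrite eucl_distC.
  (* passing from s2 w to its prefix u moves the image of y by at most D times
     the ratio of u, because the orbit of y stays in O *)
  have /prefixP[v ->] := pu; rewrite word_map_cat (word_map_dist _ _ _ hg) mulrC.
  have /andP[_ uz2] := uz.
  rewrite ler_pM ?eucl_dist_ge0 ?(ltW (word_prod_gt0 _ _ _))//.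
  by apply: OD => //; exact: word_map_stable.
- apply/allP => _ /mapP[s sL' ->]; move/allP: nL => /(_ s sL').
  rewrite /near /= !word_prod_cat !word_map_cat (word_map_dist _ _ _ hg).
  rewrite !(mulrCA _ (word_prod c s1)) !ler_pM2l//; exact: word_prod_gt0.
Qed.

(** * Measures with bounded support *)

Definition eucl_tail {R : realType} {q : nat} (y : 'rV[R]_q) (rho : R) : set (borel R q) :=
  [set x | rho < eucl_dist y x].

Lemma eucl_tail_measurable {R : realType} {q : nat} (y : 'rV[R]_q) (rho : R) :
  measurable (eucl_tail y rho).
Proof.
have := eucl_dist_measurable y measurableT `]rho, +oo[%classic (measurable_itv _).
rewrite setTI; congr measurable; apply/seteqP; split=> x /=;
  by rewrite in_itv/= andbT.
Qed.

Lemma eucl_tail_subset {R : realType} {q : nat} (y : 'rV[R]_q) (rho1 rho2 : R) :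
  rho1 <= rho2 -> eucl_tail y rho2 `<=` eucl_tail y rho1.
Proof. by move=> h x; exact: le_lt_trans. Qed.

(** Up to a bounded term, the maps contract the distance to y by a factor lam < 1,
    so beyond a radius K the preimages of the tail of radius rho lie in the tail
    of radius rho + 1. The tails then do not decrease along K, K + 1, ..., while
    their intersection is empty. *)
Lemma bounded_support {R : realType} {q n : nat} {P : probability (borel R q) R}
    {f : 'I_n -> 'rV[R]_q -> 'rV[R]_q} {a p : 'I_n -> R} {y : 'rV[R]_q} (rho1 : R) :
  (forall i, contractive_similitude (a i) (f i)) ->
  (forall i, 0 <= p i) -> \sum_i p i <= 1 ->
  (forall rho, rho1 <= rho ->
    (P (eucl_tail y rho) <= \sum_(i < n) (p i)%:E * P (f i @^-1` eucl_tail y rho))%E) ->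
  exists2 rho0 : R, 0 < rho0 & P (eucl_tail y rho0) = 0%E.
Proof.
move=> hf p0 p1 hP.
have a1 i : a i < 1 by have [/andP[]] := hf i.
have [lam /andP[lam0 lam1] alam] := fin_lt1_ubound a a1.
pose b := \sum_i eucl_dist y (f i y).
have b0 : 0 <= b by apply: sumr_ge0 => i _; exact: eucl_dist_ge0.
have fb i x : eucl_dist y (f i x) <= b + lam * eucl_dist y x.
  apply: le_trans (eucl_dist_triangle (f i y) _ _) _; apply: lerD.
    by rewrite /b (bigD1 i)//= lerDl sumr_ge0// => j _; exact: eucl_dist_ge0.
  by have [_ ->] := hf i; rewrite ler_wpM2r// eucl_dist_ge0.
(* from this radius on, b + lam (rho + 1) <= rho *)
pose K := Num.max rho1 ((b + lam) / (1 - lam)) + 1.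
have step rho : K <= rho -> (P (eucl_tail y rho) <= P (eucl_tail y (rho + 1)))%E.
  move=> Krho.
  have rho1_le : rho1 <= rho.
    by apply: le_trans Krho; rewrite ler_wpDr// le_max lexx.
  have lamK : b + lam <= rho * (1 - lam).
    rewrite -ler_pdivrMr ?subr_gt0//; apply: le_trans Krho.
    by rewrite ler_wpDr// le_max lexx orbT.
  apply: le_trans (hP _ rho1_le) _.
  apply: (@le_trans _ _ (\sum_(i < n) (p i)%:E * P (eucl_tail y (rho + 1)))%E).
    apply: lee_sum => i _; apply: lee_wpmul2l; first by rewrite lee_fin.
    apply: le_measure; rewrite ?inE; last 1 first.
    - move=> x /=; rewrite /eucl_tail/= => h; rewrite ltNge; apply/negP => h'.
      have : lam * eucl_dist y x <= lam * (rho + 1) by rewrite ler_wpM2l// ltW.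
      by have := fb i x; move: lamK h; rewrite mulrBr mulrDr !mulr1 (mulrC rho); lra.
    - have /(_ measurableT) := continuous_borel_measurable _ (similitude_continuous (hf i)).
      move=> /(_ _ (eucl_tail_measurable y rho)); by rewrite setTI.
    - exact: eucl_tail_measurable.
  rewrite -ge0_sume_distrl => [|i _]; last by rewrite lee_fin.
  by rewrite sumEFin gee_pMl.
have stepn k : (P (eucl_tail y K) <= P (eucl_tail y (K + k%:R)))%E.
  elim: k => [|k IH]; first by rewrite addr0.
  by apply: le_trans IH _; rewrite -natr1 addrA; apply: step; rewrite lerDl.
exists K.
  apply: ltr_wpDl => //; rewrite le_max [X in _ || X]divr_ge0 ?orbT//.
    by rewrite addr_ge0// ltW.
  by rewrite subr_ge0 ltW.
apply/eqP; rewrite eq_le measure_ge0 andbT.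
pose F k := eucl_tail y (K + k%:R).
have capF : \bigcap_k F k = set0.
  apply/seteqP; split => // x Fx.
  have := Fx (Num.truncn (eucl_dist y x - K)).+1 I; rewrite /F/eucl_tail/=.
  have := truncnS_gt (eucl_dist y x - K); lra.
rewrite -(measure0 P) -capF.
apply: (@cvge_ge _ \oo _ _ (P \o F)); first by apply: nearW => k; exact: stepn.
apply: nonincreasing_cvg_mu => [|i||m k mk].
- by rewrite (le_lt_trans (probability_le1 _ _)) ?ltry//; exact: eucl_tail_measurable.
- exact: eucl_tail_measurable.
- by rewrite capF.
- by apply/subsetPset; apply: eucl_tail_subset; rewrite lerD2l ler_nat.
Qed.

Lemma integral_ge_ball {R : realType} {q : nat} {P : probability (borel R q) R}
    (K rho : R) (y : 'rV[R]_q) (F : borel R q -> \bar R) :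
  0 <= K -> measurable_fun setT F -> (forall x, 0 <= F x)%E ->
  P (eucl_tail y rho) = 0%E ->
  (forall x, eucl_dist y x <= rho -> (K%:E <= F x)%E) -> (K%:E <= \int[P]_x F x)%E.
Proof.
move=> K0 mF F0 Py KF; apply: (@le_trans _ _ (\int[P]_x (cst K%:E x))%E).
  rewrite integral_cst// -[leLHS]mule1; apply: lee_wpmul2l; first by rewrite lee_fin.
  by rewrite le_eqVlt; apply/orP; left; apply/eqP/esym; exact: probability_setT.
apply: ae_ge0_le_integral => //.
exists (eucl_tail y rho); split => //; first exact: eucl_tail_measurable.
move=> x /= /not_implyP[_]; rewrite /eucl_tail/= ltNge => h; apply/negP => yx.
by apply: h; exact: KF.
Qed.

(** * Distortion *)

Definition distortion {R : realType} {q : nat} (P : probability (borel R q) R) (r : R)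
    (alpha : set 'rV[R]_q) : \bar R :=
  \int[P]_x (dist_to x alpha `^ r)%:E.

Lemma distortion_ge0 {R : realType} {q : nat} (P : probability (borel R q) R) (r : R)
    (alpha : set 'rV[R]_q) : (0 <= distortion P r alpha)%E.
Proof. by apply: integral_ge0 => x _; rewrite lee_fin powR_ge0. Qed.

Lemma distortion_point_le {R : realType} {q : nat} {P : probability (borel R q) R}
    (r : R) {y : 'rV[R]_q} {rho : R} :
  0 < r -> 0 < rho -> P (eucl_tail y rho) = 0%E ->
  (distortion P r [set` [:: y]] <= (rho `^ r)%:E)%E.
Proof.
move=> r0 rho0 Py.
have y0 : [set` [:: y]] !=set0 by exists y; rewrite /= inE.
apply: (@le_trans _ _ (\int[P]_x (cst (rho `^ r)%:E x))%E); last first.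
  rewrite integral_cst// -[leRHS]mule1; apply: lee_wpmul2l; first by rewrite lee_fin powR_ge0.
  exact: probability_le1.
apply: ae_ge0_le_integral => //.
- by move=> x _; rewrite lee_fin powR_ge0.
- exact: dist_to_powR_measurable.
- by move=> x _; rewrite lee_fin powR_ge0.
exists (eucl_tail y rho); split => //; first exact: eucl_tail_measurable.
move=> x /=; rewrite /eucl_tail /= => /not_implyP[_]; rewrite ltNge => h; apply/negP => yx.
apply: h; rewrite lee_fin; apply: ge0_ler_powR;
  rewrite ?nnegrE ?(ltW r0) ?(ltW rho0) ?dist_to_ge0//.
have yS : [set` [:: y]] y by rewrite /= inE.
by apply: le_trans (dist_to_le x yS) _; rewrite eucl_distC.
Qed.

Lemma distortion_mixture {R : realType} {q n : nat} (w : 'I_n -> R)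
    (P : probability (borel R q) R) (Q : 'I_n -> probability (borel R q) R)
    (h : 'I_n -> 'rV[R]_q -> 'rV[R]_q) (r : R) (alpha : set 'rV[R]_q) :
  (forall i, 0 <= w i) -> (forall i, continuous (h i)) ->
  (forall A : set (borel R q), measurable A ->
    (P A = \sum_(i < n) (w i)%:E * Q i (h i @^-1` A))%E) ->
  alpha !=set0 ->
  (distortion P r alpha =
    \sum_(i < n) (w i)%:E * \int[Q i]_x (dist_to (h i x) alpha `^ r)%:E)%E.
Proof.
move=> w0 hc PQ a0; rewrite /distortion.
rewrite (integral_mixture w P Q h (fun x => (dist_to x alpha `^ r)%:E))//.
- by move=> i; apply: continuous_borel_measurable.
- exact: dist_to_powR_measurable.
- by move=> x; rewrite lee_fin powR_ge0.
Qed.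

(** * Upper bounds *)

(** The inequality, least distortion over n points = O(n^(- rho)), with a real
    budget x in place of n: budgets, unlike cardinalities, can be split in exact
    proportions. *)
Definition has_covers {R : realType} {q : nat} (P : probability (borel R q) R)
    (r rho : R) : Prop :=
  exists C D : R, [/\ 0 < C, 0 < D & forall x, 1 <= x -> exists S : seq 'rV[R]_q,
    [/\ S != [::], (size S)%:R <= C * x
      & (distortion P r [set` S] <= (D * x `^ (- rho))%:E)%E]].

Lemma exists_expr_le {R : realType} (lam x : R) :
  0 < lam < 1 -> 0 < x -> exists k, x * lam ^+ k <= 1.
Proof.
move=> /andP[lam0 lam1] x0.
have lam_norm : `|lam| < 1 by rewrite gtr0_norm.
have := cvg_expr lam_norm; move=> /cvgrPdist_le /(_ x^-1).
rewrite invr_gt0 => /(_ x0) [k _ /(_ k (leqnn k))] /=.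
rewrite sub0r normrN ger0_norm ?exprn_ge0 ?(ltW lam0)// => hk.
by exists k; rewrite mulrC -ler_pdivlMr// mul1r.
Qed.

(** Split a budget x > 1 into budgets x v_i for the n pieces, and apply the step.
    Since v_i^(1 + rho) (x v_i)^(- rho) = v_i x^(- rho), the bounds C x and
    D x^(- rho) reproduce under the two conditions on C and D. Budgets shrink by a
    factor lam < 1, and recursion stops between vmin and 1, where one point will do. *)
Lemma cover_recursion {R : realType} {T : eqType} {n : nat} (v : 'I_n -> R)
    (rho vmin C C0 D D0 : R) (cost : seq T -> R -> Prop) :
  0 < vmin -> (forall i, vmin <= v i) -> (forall i, v i < 1) ->
  0 <= rho -> 0 <= D -> 1 <= C * vmin ->
  C0 + (\sum_i v i) * C <= C -> D0 + (\sum_i v i) * D <= D ->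
  (forall S d d', d <= d' -> cost S d -> cost S d') ->
  (exists y, cost [:: y] D) ->
  (forall x, 1 <= x -> forall (S : 'I_n -> seq T) (d : 'I_n -> R),
    (forall i, S i != [::]) -> (forall i, cost (S i) (d i)) ->
    exists S', [/\ S' != [::], (size S')%:R <= C0 * x + \sum_i (size (S i))%:R
      & cost S' (D0 * x `^ (- rho) + \sum_i v i `^ (1 + rho) * d i)]) ->
  forall x, vmin <= x -> exists S,
    [/\ S != [::], (size S)%:R <= C * x & cost S (D * x `^ (- rho))].
Proof.
move=> vm0 vm v1 rho0 D0' Cvm hC hD mono [y cy] step.
have [lam /andP[lam0 lam1] vlam] := fin_lt1_ubound v v1.
have v0 i : 0 < v i by exact: lt_le_trans (vm i).
have C_gt0 : 0 < C by rewrite -(pmulr_lgt0 C vm0) (lt_le_trans _ Cvm).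
have base x : vmin <= x -> x <= 1 -> exists S,
    [/\ S != [::], (size S)%:R <= C * x & cost S (D * x `^ (- rho))].
  move=> xv x1; exists [:: y]; split=> //=.
    by apply: le_trans Cvm _; rewrite ler_pM2l.
  apply: mono cy; rewrite -[leLHS]mulr1 ler_wpM2l//.
  have x0 : 0 < x by exact: lt_le_trans xv.
  rewrite -[leLHS](powRr0 x); apply: ger_powR; first by rewrite x0.
  by rewrite oppr_le0.
suff main k x : vmin <= x -> x * lam ^+ k <= 1 -> exists S,
    [/\ S != [::], (size S)%:R <= C * x & cost S (D * x `^ (- rho))].
  move=> x xv; have x0 : 0 < x by exact: lt_le_trans xv.
  have lam01 : 0 < lam < 1 by rewrite lam0.
  by have [k xk] := exists_expr_le lam x lam01 x0; exact: main k _ xv xk.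
elim: k x => [|k IH] x xv xk; first by apply: base => //; rewrite expr0 mulr1 in xk.
have [x1|/ltW x1] := leP x 1; first exact: base.
have x0 : 0 < x by exact: lt_le_trans ltr01 x1.
have /choice[S hS] : forall i, exists S,
    [/\ S != [::], (size S)%:R <= C * (x * v i) & cost S (D * (x * v i) `^ (- rho))].
  move=> i; apply: IH.
    by rewrite -[leLHS]mul1r ler_pM// ltW.
  apply: le_trans xk; rewrite exprS mulrA ler_wpM2r ?exprn_ge0 ?(ltW lam0)//.
  by rewrite ler_pM2l.
have [||S' [S'0 sS' cS']] := step x x1 S (fun i => D * (x * v i) `^ (- rho)).
- by move=> i; have [] := hS i.
- by move=> i; have [] := hS i.
exists S'; split => //.
  apply: le_trans sS' _; apply: (@le_trans _ _ (C0 * x + \sum_i C * (x * v i))).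
    by rewrite lerD2l; apply: ler_sum => i _; have [] := hS i.
  rewrite -!mulr_sumr.
  have -> : C0 * x + C * (x * \sum_i v i) = (C0 + (\sum_i v i) * C) * x by ring.
  by rewrite ler_pM2r.
apply: mono cS'.
have -> : \sum_i v i `^ (1 + rho) * (D * (x * v i) `^ (- rho)) =
    (\sum_i v i) * D * x `^ (- rho).
  rewrite !mulr_suml; apply: eq_bigr => i _.
  rewrite powRM ?(ltW x0) ?(ltW (v0 i))//.
  have vE : v i `^ (1 + rho) * v i `^ (- rho) = v i.
    by rewrite -powRD ?addrK ?powRr1 ?ltW// gt_eqF ?implybT.
  by rewrite -[in RHS]vE; ring.
by rewrite -mulrDl ler_wpM2r ?powR_ge0.
Qed.

Definition image_cover {R : realType} {q n : nat} (f : 'I_n -> 'rV[R]_q -> 'rV[R]_q)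
  (S : 'I_n -> seq 'rV[R]_q) : seq 'rV[R]_q :=
  flatten [seq map (f i) (S i) | i <- enum 'I_n].

Lemma size_image_cover {R : realType} {q n : nat} (f : 'I_n -> 'rV[R]_q -> 'rV[R]_q)
    (S : 'I_n -> seq 'rV[R]_q) :
  (size (image_cover f S))%:R = \sum_i (size (S i))%:R :> R.
Proof.
rewrite size_flatten /shape -map_comp sumnE big_map big_enum/= natr_sum.
by apply: eq_bigr => i _; rewrite size_map.
Qed.

Lemma image_sub_image_cover {R : realType} {q n : nat}
    (f : 'I_n -> 'rV[R]_q -> 'rV[R]_q) (S : 'I_n -> seq 'rV[R]_q) i :
  f i @` [set` S i] `<=` [set` image_cover f S].
Proof.
move=> _ [x /= xS <-]; apply/flatten_mapP; exists i; rewrite ?mem_enum//.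
exact: map_f.
Qed.

Lemma set_seq_neq0 {T : eqType} (S : seq T) : S != [::] -> [set` S] !=set0.
Proof. by case: S => // x S _; exists x; rewrite /= inE eqxx. Qed.

Lemma distortion_image_le {R : realType} {q : nat} (Q : probability (borel R q) R)
    (h : 'rV[R]_q -> 'rV[R]_q) (a r : R) (alpha beta : set 'rV[R]_q) :
  contractive_similitude a h -> 0 < r -> alpha !=set0 -> h @` alpha `<=` beta ->
  (\int[Q]_x (dist_to (h x) beta `^ r)%:E <= (a `^ r)%:E * distortion Q r alpha)%E.
Proof.
move=> ha r0 al0 hab; have [/andP[a0 _] _] := ha.
have be0 : beta !=set0 by have [x ax] := al0; exists (h x); apply: hab; exists x.
rewrite /distortion -ge0_integralZl//=; last 3 first.
- exact: dist_to_powR_measurable.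
- by move=> x _; rewrite lee_fin powR_ge0.
- by rewrite lee_fin powR_ge0.
apply: ge0_le_integral => //.
- by move=> x _; rewrite lee_fin powR_ge0.
- apply: (measurableT_comp (dist_to_powR_measurable beta r be0)).
  exact: continuous_borel_measurable (similitude_continuous ha).
- by apply: measurable_funeM; exact: dist_to_powR_measurable.
move=> x _; rewrite -EFinM lee_fin -powRM ?(ltW a0) ?dist_to_ge0//.
apply: ge0_ler_powR; rewrite ?nnegrE ?(ltW r0) ?dist_to_ge0//.
  by rewrite mulr_ge0 ?(ltW a0) ?dist_to_ge0.
exact: dist_to_image.
Qed.

Lemma self_similar_distortion {R : realType} {q M : nat}
    {g : 'I_M -> 'rV[R]_q -> 'rV[R]_q} {c t : 'I_M -> R}
    {nu : probability (borel R q) R} (r : R) (alpha : set 'rV[R]_q) :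
  (forall i, contractive_similitude (c i) (g i)) -> (forall i, 0 < t i) ->
  self_similar_measure g t nu -> alpha !=set0 ->
  (distortion nu r alpha =
    \sum_(i < M) (t i)%:E * \int[nu]_x (dist_to (g i x) alpha `^ r)%:E)%E.
Proof.
move=> hg ht hnu al0; apply: (distortion_mixture t nu (fun=> nu) g) => //.
  by move=> i; exact: ltW.
by move=> i; exact: similitude_continuous (hg i).
Qed.

(** The condensation identity is a mixture over N + 1 indices, where the index 0
    carries nu and the identity map. *)
Lemma condensation_distortion {R : realType} {q N : nat}
    {f : 'I_N -> 'rV[R]_q -> 'rV[R]_q} {a : 'I_N -> R} {p : 'I_N.+1 -> R}
    {nu mu : probability (borel R q) R} (r : R) (alpha : set 'rV[R]_q) :
  (forall i, contractive_similitude (a i) (f i)) -> (forall i, 0 < p i) ->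
  condensation_measure f p nu mu -> alpha !=set0 ->
  (distortion mu r alpha = (p ord0)%:E * distortion nu r alpha
    + \sum_(i < N) (p (lift ord0 i))%:E
        * \int[mu]_x (dist_to (f i x) alpha `^ r)%:E)%E.
Proof.
move=> hf hp hmu al0.
pose Q (i : 'I_N.+1) := if unlift ord0 i is Some _ then mu else nu.
pose h i := if unlift ord0 i is Some j then f j else id.
have [Q0 h0] : Q ord0 = nu /\ h ord0 = id by rewrite /Q /h unlift_none.
have QL j : Q (lift ord0 j) = mu by rewrite /Q liftK.
have hL j : h (lift ord0 j) = f j by rewrite /h liftK.
rewrite (distortion_mixture p mu Q h)//.
- rewrite big_ord_recl Q0 h0 /=.
  under eq_bigr => i _ do rewrite QL hL.
  by [].
- by move=> i; exact: ltW.
- move=> i; rewrite /h; case: unliftP => [j _|_]; last by move=> x; exact: cvg_id.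
  exact: similitude_continuous (hf j).
- move=> A mA; rewrite big_ord_recl Q0 h0; apply: etrans (hmu A mA) _.
  by congr (_ + _)%E; apply: eq_bigr => i _; rewrite QL hL.
Qed.

(** [cover_recursion] without inhomogeneous part: the weights sum to 1, hence any
    C and D large enough for the base case are preserved. *)
Lemma self_similar_covers {R : realType} {q M : nat}
    {g : 'I_M -> 'rV[R]_q -> 'rV[R]_q} {c t w : 'I_M -> R}
    {nu : probability (borel R q) R} {r rho rho0 : R} {y : 'rV[R]_q} :
  (0 < M)%N -> (forall i, contractive_similitude (c i) (g i)) ->
  (forall i, 0 < t i) -> self_similar_measure g t nu -> 0 < r -> 0 <= rho ->
  (forall i, 0 < w i < 1) -> \sum_i w i = 1 ->
  (forall i, t i * c i `^ r = w i `^ (1 + rho)) ->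
  0 < rho0 -> nu (eucl_tail y rho0) = 0%E ->
  has_covers nu r rho.
Proof.
move=> M0 hg ht hnu r0 rho_ge0 w01 w1 hw rho00 ytail.
have [wm /andP[wm0 wm1] wmw] : exists2 m, 0 < m <= 1 & forall i, m <= w i.
  by apply: fin_pos_lbound => i; have /andP[] := w01 i.
exists wm^-1, (rho0 `^ r); split; rewrite ?invr_gt0 ?powR_gt0// => x x1.
apply: (@cover_recursion _ _ _ w rho wm wm^-1 0 (rho0 `^ r) 0
  (fun S d => (distortion nu r [set` S] <= d%:E)%E)) => //.
- by move=> i; have /andP[] := w01 i.
- exact: powR_ge0.
- by rewrite mulVf// gt_eqF.
- by rewrite w1 add0r mul1r.
- by rewrite w1 add0r mul1r.
- by move=> S d d' dd' h; apply: le_trans h _; rewrite lee_fin.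
- by exists y; exact: distortion_point_le.
- move=> z z1 S d S0 Sd; exists (image_cover g S); split.
  + have i0 : 'I_M := Ordinal M0.
    rewrite -size_eq0 -lt0n -(ltr_nat R) size_image_cover (bigD1 i0)//=.
    by rewrite ltr_pwDl ?sumr_ge0// ltr0n lt0n size_eq0.
  + by rewrite size_image_cover mul0r add0r.
  + have ne0 : [set` image_cover g S] !=set0.
      have [x' xS] := set_seq_neq0 _ (S0 (Ordinal M0)).
      by exists (g (Ordinal M0) x'); apply: (image_sub_image_cover g S (Ordinal M0)); exists x'.
    rewrite (self_similar_distortion r _ hg ht hnu)// mul0r add0r -sumEFin.
    apply: lee_sum => i _; rewrite -hw -mulrA EFinM.
    apply: lee_wpmul2l; first by rewrite lee_fin ltW.
    apply: le_trans (distortion_image_le _ _ _ _ _ _ (hg i) r0 (set_seq_neq0 _ (S0 i))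
      (image_sub_image_cover g S i)) _.
    by rewrite EFinM; apply: lee_wpmul2l; rewrite ?lee_fin ?powR_ge0.
- exact: le_trans x1.
Qed.

(** [cover_recursion] with a codebook for nu of budget x as inhomogeneous part;
    the defect 1 - kap of the sum of the weights absorbs its cost. *)
Lemma condensation_covers {R : realType} {q N : nat}
    {f : 'I_N -> 'rV[R]_q -> 'rV[R]_q} {a v : 'I_N -> R} {p : 'I_N.+1 -> R}
    {nu mu : probability (borel R q) R} {r rho rho0 : R} {y : 'rV[R]_q} :
  (forall i, contractive_similitude (a i) (f i)) ->
  (forall i, 0 < p i) -> condensation_measure f p nu mu -> 0 < r -> 0 <= rho ->
  (forall i, 0 < v i < 1) -> \sum_i v i < 1 ->
  (forall i, p (lift ord0 i) * a i `^ r = v i `^ (1 + rho)) ->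
  0 < rho0 -> mu (eucl_tail y rho0) = 0%E ->
  has_covers nu r rho -> has_covers mu r rho.
Proof.
move=> hf hp hmu r0 rho_ge0 v01 v1 hv rho00 ytail [Cnu [Dnu [Cnu0 Dnu0 cnu]]].
have [vm /andP[vm0 vm1] vmv] : exists2 m, 0 < m <= 1 & forall i, m <= v i.
  by apply: fin_pos_lbound => i; have /andP[] := v01 i.
set kap := \sum_i v i in v1 *.
have kap1 : 0 < 1 - kap by rewrite subr_gt0.
pose C := Num.max vm^-1 (Cnu / (1 - kap)).
pose D := Num.max (rho0 `^ r) (p ord0 * Dnu / (1 - kap)).
have C0 : 0 < C by rewrite lt_max invr_gt0 vm0.
have D0 : 0 < D by rewrite lt_max powR_gt0.
exists C, D; split => // x x1.
apply: (@cover_recursion _ _ _ v rho vm C Cnu D (p ord0 * Dnu)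
  (fun S d => (distortion mu r [set` S] <= d%:E)%E)) => //.
- by move=> i; have /andP[] := v01 i.
- exact: ltW.
- by rewrite -ler_pdivrMr// mul1r le_max lexx.
- have : Cnu / (1 - kap) <= C by rewrite le_max lexx orbT.
  by rewrite ler_pdivrMr// mulrBr mulr1 [C * _]mulrC lerBrDr.
- have : p ord0 * Dnu / (1 - kap) <= D by rewrite le_max lexx orbT.
  by rewrite ler_pdivrMr// mulrBr mulr1 [D * _]mulrC lerBrDr.
- by move=> S d d' dd' h; apply: le_trans h _; rewrite lee_fin.
- exists y; apply: le_trans (distortion_point_le r r0 rho00 ytail) _.
  by rewrite lee_fin le_max lexx.
- move=> z z1 S d S0 Sd; have [S1 [S10 sS1 dS1]] := cnu z z1.
  have S1ne := set_seq_neq0 _ S10.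
  have sub1 : [set` S1] `<=` [set` S1 ++ image_cover f S].
    by move=> x' /= x'S; rewrite mem_cat x'S.
  have ne0 : [set` S1 ++ image_cover f S] !=set0.
    by have [x' x'S] := S1ne; exists x'; exact: sub1.
  exists (S1 ++ image_cover f S); split.
  + by rewrite -size_eq0 size_cat addn_eq0 size_eq0 negb_and S10.
  + by rewrite size_cat natrD size_image_cover lerD2r.
  + rewrite (condensation_distortion r _ hf hp hmu)// EFinD; apply: leeD.
      rewrite -mulrA EFinM; apply: lee_wpmul2l; first by rewrite lee_fin ltW.
      apply: le_trans dS1; apply: ge0_le_integral => //.
      * by move=> x' _; rewrite lee_fin powR_ge0.
      * exact: dist_to_powR_measurable.
      * exact: dist_to_powR_measurable.
      * move=> x' _; rewrite lee_fin; apply: ge0_ler_powR; rewrite ?nnegrE ?(ltW r0)//.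
        - exact: dist_to_ge0.
        - exact: dist_to_ge0.
        - exact: dist_to_subset.
    rewrite -sumEFin; apply: lee_sum => i _; rewrite -hv -mulrA EFinM.
    apply: lee_wpmul2l; first by rewrite lee_fin ltW.
    apply: (@le_trans _ _ ((a i `^ r)%:E * distortion mu r [set` S i])%E).
      apply: (distortion_image_le _ _ _ _ _ _ (hf i) r0 (set_seq_neq0 _ (S0 i))).
      move=> x' /image_sub_image_cover /= h; rewrite mem_cat.
      by apply/orP; right.
    by rewrite EFinM; apply: lee_wpmul2l; rewrite ?lee_fin ?powR_ge0.
- exact: le_trans x1.
Qed.

(** * Lower bound *)

(** Cut the tree of words where x w_s first drops to at most 1. The third
    property says that these words form a full section of the tree; it is used for
    the integrals against nu and for the weights w_s themselves. *)
Lemma stopping_words {R : realType} {M : nat} {w : 'I_M -> R} {wm x : R} :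
  0 < wm <= 1 -> (forall i, wm <= w i) -> (forall i, w i < 1) -> 1 <= x ->
  exists G : seq (seq 'I_M), [/\ pairwise incomparable G,
    forall s, s \in G -> wm <= x * word_prod w s <= 1
    & forall Phi : seq 'I_M -> \bar R,
        (forall s, Phi s = \sum_(i < M) Phi (rcons s i))%E ->
        (Phi [::] = \sum_(s <- G) Phi s)%E].
Proof.
move=> /andP[wm0 wm1] wmw w1 x1.
have [lam /andP[lam0 lam1] wlam] := fin_lt1_ubound w w1.
have lam01 : 0 < lam < 1 by rewrite lam0.
have [k xk] := exists_expr_le lam x lam01 (lt_le_trans ltr01 x1).
have {x1} xwm : wm <= x by exact: le_trans x1.
elim: k x xwm xk => [|k IH] x xwm xk.
  exists [:: [::]]; split=> //.
    move=> s; rewrite inE => /eqP ->; rewrite /word_prod big_nil mulr1 xwm/=.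
    by rewrite expr0 mulr1 in xk.
  by move=> Phi _; rewrite big_seq1.
have [x1|/ltW x1] := leP x 1.
  exists [:: [::]]; split=> //.
    by move=> s; rewrite inE => /eqP ->; rewrite /word_prod big_nil mulr1 xwm/=.
  by move=> Phi _; rewrite big_seq1.
have x0 : 0 < x by exact: lt_le_trans ltr01 x1.
have /choice[G hG] : forall i, exists G : seq (seq 'I_M), [/\ pairwise incomparable G,
    forall s, s \in G -> wm <= (x * w i) * word_prod w s <= 1
    & forall Phi : seq 'I_M -> \bar R,
        (forall s, Phi s = \sum_(i < M) Phi (rcons s i))%E ->
        (Phi [::] = \sum_(s <- G) Phi s)%E].
  move=> i; apply: IH; first by rewrite -[leLHS]mul1r ler_pM// ltW.
  apply: le_trans xk; rewrite exprS mulrA ler_wpM2r ?exprn_ge0 ?(ltW lam0)//.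
  by rewrite ler_pM2l.
exists (flatten [seq map (cons i) (G i) | i <- enum 'I_M]); split.
- elim: (enum 'I_M) (enum_uniq 'I_M) => //= i l IHl /andP[il ul].
  rewrite pairwise_cat IHl// andbT pairwise_map; apply/andP; split.
    apply/allrelP => s1 s2 /mapP[u1 _ ->] /flatten_mapP[j jl] /mapP[u2 _ ->].
    have ij : i != j by apply: contraNneq il => ->.
    by rewrite /incomparable !prefix_cons (negPf ij) eq_sym (negPf ij).
  have [pG _ _] := hG i; apply: sub_pairwise pG => u1 u2 /=.
  by rewrite /incomparable !prefix_cons eqxx.
- move=> _ /flatten_mapP[i _] /mapP[u uG ->]; have [_ /(_ u uG) + _] := hG i.
  by rewrite word_prod_cons mulrA.
move=> Phi hPhi; rewrite big_flatten big_map big_enum/= hPhi.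
apply: eq_bigr => i _; rewrite big_map.
have [_ _ /(_ (fun s => Phi (i :: s))) -> //] := hG i.
Qed.

Lemma word_map_continuous {R : realType} {q M : nat}
    {g : 'I_M -> 'rV[R]_q -> 'rV[R]_q} {c : 'I_M -> R} (s : seq 'I_M) :
  (forall i, contractive_similitude (c i) (g i)) -> continuous (word_map g s).
Proof.
move=> hg; apply: (eucl_lipschitz_continuous (word_prod c s)) => x y.
by rewrite -(word_map_dist _ _ _ hg); exact: norm_le_eucl_dist.
Qed.

Lemma self_similar_integral_word {R : realType} {q M : nat}
    {g : 'I_M -> 'rV[R]_q -> 'rV[R]_q} {c t : 'I_M -> R}
    {nu : probability (borel R q) R} (F : borel R q -> \bar R) (s : seq 'I_M) :
  (forall i, contractive_similitude (c i) (g i)) -> (forall i, 0 < t i) ->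
  self_similar_measure g t nu ->
  measurable_fun setT F -> (forall x, 0 <= F x)%E ->
  ((word_prod t s)%:E * \int[nu]_x F (word_map g s x) =
   \sum_(i < M) (word_prod t (rcons s i))%:E
      * \int[nu]_x F (word_map g (rcons s i) x))%E.
Proof.
move=> hg ht hnu mF F0.
rewrite (integral_mixture t nu (fun=> nu) g (fun x => F (word_map g s x)))//.
- rewrite ge0_sume_distrr => [|i _]; last first.
    by rewrite mule_ge0 ?lee_fin ?(ltW (ht i))// integral_ge0.
  apply: eq_bigr => i _; rewrite muleA -EFinM -cats1 word_prod_cat.
  rewrite [word_prod t [:: i]]big_seq1; congr (_ * _)%E.
  by apply: eq_integral => x _; rewrite word_map_cat.
- by move=> i; exact: ltW.
- by move=> i; apply: continuous_borel_measurable; exact: similitude_continuous (hg i).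
- apply: (measurableT_comp mF); apply: continuous_borel_measurable.
  exact: word_map_continuous hg.
Qed.

Lemma self_similar_integral_word_le {R : realType} {q M : nat}
    {g : 'I_M -> 'rV[R]_q -> 'rV[R]_q} {c t : 'I_M -> R}
    {nu : probability (borel R q) R} (F : borel R q -> \bar R) (s u : seq 'I_M) :
  (forall i, contractive_similitude (c i) (g i)) -> (forall i, 0 < t i) ->
  self_similar_measure g t nu ->
  measurable_fun setT F -> (forall x, 0 <= F x)%E ->
  ((word_prod t (s ++ u))%:E * \int[nu]_x F (word_map g (s ++ u) x) <=
   (word_prod t s)%:E * \int[nu]_x F (word_map g s x))%E.
Proof.
move=> hg ht hnu mF F0; elim/last_ind: u => [|u i IH]; first by rewrite cats0.
apply: le_trans IH; rewrite (self_similar_integral_word F (s ++ u) hg ht hnu)//.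
rewrite (bigD1 i)//= -rcons_cat leeDl// sume_ge0// => j _.
by rewrite mule_ge0 ?integral_ge0// lee_fin ltW// word_prod_gt0.
Qed.

Lemma word_prod_powR {R : realType} {M : nat} {c t w : 'I_M -> R} {r rho : R}
    (s : seq 'I_M) :
  (forall i, 0 < c i) -> (forall i, 0 < t i) -> (forall i, 0 < w i) ->
  (forall i, t i * c i `^ r = w i `^ (1 + rho)) ->
  word_prod t s * word_prod c s `^ r = word_prod w s `^ (1 + rho).
Proof.
move=> c0 t0 w0 hw; elim: s => [|i s IH].
  by rewrite /word_prod !big_nil !powR1 mulr1.
rewrite !word_prod_cons !powRM ?ltW ?word_prod_gt0// -hw -IH; ring.
Qed.

(** For a codebook of n points take the section of the tree at x = 2 n. It has at
    least 2 n words, as the w_s sum to 1 and are at most 1 / x. Tails with the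
    constant 2 (rho0 + 1) make the balls of radius (rho0 + 1) c_(s u) around the
    points g_(s u)(y) disjoint; pieces live in the balls of radius rho0 c_(s u),
    so a piece whose larger ball misses the codebook has distance at least
    c_(s u) to it. *)
Lemma self_similar_distortion_lower {R : realType} {q M : nat}
    {g : 'I_M -> 'rV[R]_q -> 'rV[R]_q} {c t w : 'I_M -> R} {O : set 'rV[R]_q}
    {nu : probability (borel R q) R} {r rho rho0 : R} {y : 'rV[R]_q} :
  (forall i, contractive_similitude (c i) (g i)) -> osc_set g O -> O y ->
  (forall i, 0 < t i) -> self_similar_measure g t nu -> 0 < r -> 0 <= rho ->
  (forall i, 0 < w i < 1) -> \sum_i w i = 1 ->
  (forall i, t i * c i `^ r = w i `^ (1 + rho)) ->
  0 < rho0 -> nu (eucl_tail y rho0) = 0%E ->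
  exists2 k : R, 0 < k & forall n (e : 'I_n.+1 -> 'rV[R]_q),
    ((k * n.+1%:R `^ (- rho))%:E <= distortion nu r (range e))%E.
Proof.
move=> hg hO Oy ht hnu r0 rho_ge0 w01 w1 hw rho00 ytail.
have c0 i : 0 < c i by have [/andP[]] := hg i.
have w0 i : 0 < w i by have /andP[] := w01 i.
have w_lt1 i : w i < 1 by have /andP[] := w01 i.
have [wm wm01 wmw] := fin_pos_lbound w w0; have /andP[wm0 wm1] := wm01.
have [u usep] := separated_tails (2 * (rho0 + 1)) hg hO Oy.
pose ku := word_prod t u * word_prod c u `^ r.
have ku0 : 0 < ku by rewrite mulr_gt0 ?powR_gt0 ?word_prod_gt0.
exists (ku * (wm / 2) `^ (1 + rho)).
  by rewrite mulr_gt0// powR_gt0// divr_gt0.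
move=> m e; set n := m.+1; pose x : R := 2 * n%:R.
have n0 : 0 < n%:R :> R by rewrite ltr0n.
have x1 : 1 <= x by rewrite /x -natrM ler1n.
have x0 : 0 < x by exact: lt_le_trans x1.
have [G [pwG wG addG]] := stopping_words wm01 wmw w_lt1 x1.
pose z s := word_map g (s ++ u) y.
pose cu s := word_prod c (s ++ u).
have cu0 s : 0 < cu s by exact: word_prod_gt0.
pose hit s j := eucl_dist (z s) (e j) < (rho0 + 1) * cu s.
pose bad s := [exists j, hit s j].
have e0 : range e !=set0 by exists (e ord0), ord0.
(* each point of the codebook lies in at most one of the disjoint balls *)
have badG : (count bad G <= n)%N.
  pose idx s := odflt ord0 [pick j | hit s j].
  have idxP s : bad s -> hit s (idx s).
    rewrite /idx => /existsP[j hj]; case: pickP => [//|/(_ j)].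
    by rewrite hj.
  have inj_idx s1 s2 : bad s1 -> bad s2 -> incomparable s1 s2 -> idx s1 != idx s2.
    move=> /idxP h1 /idxP h2; wlog le21 : s1 s2 h1 h2 / cu s2 <= cu s1.
      move=> wl inc; have [le|/ltW le] := leP (cu s2) (cu s1); first exact: wl.
      by rewrite eq_sym wl// incomparableC.
    move=> inc; apply/eqP => jE; have := usep s1 s2 inc le21.
    rewrite ltNge => /negP; apply.
    apply: le_trans (eucl_dist_triangle (e (idx s1)) _ _) _.
    rewrite -mulrA mulr_natl mulr2n; apply: lerD; first exact: ltW h1.
    rewrite jE eucl_distC (le_trans (ltW h2))// ler_wpM2l// addr_ge0// ltW//.
  rewrite -size_filter -(size_map idx) -[n]card_ord -(card_uniqP _) ?max_card//.
  rewrite uniq_pairwise pairwise_map.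
  apply: (@sub_in_pairwise _ bad incomparable).
  - by move=> s1 s2 b1 b2 /=; exact: inj_idx.
  - exact: filter_all.
  - exact: pairwise_filter pwG.
have sizeG : (2 * n <= size G)%N.
  have addw s : (word_prod w s)%:E = (\sum_(i < M) (word_prod w (rcons s i))%:E)%E.
    rewrite sumEFin; congr EFin; rewrite -[LHS]mulr1 -w1 mulr_sumr.
    apply: eq_bigr => i _; rewrite -cats1 word_prod_cat; congr (_ * _).
    by rewrite /word_prod big_seq1.
  have := addG (fun s => (word_prod w s)%:E) addw.
  rewrite sumEFin => -[]; rewrite {1}/word_prod big_nil => wG1.
  have xE : x = \sum_(s <- G) x * word_prod w s by rewrite -mulr_sumr -wG1 mulr1.
  have GE : (size G)%:R = \sum_(s <- G) 1 :> R.
    by rewrite big_const_seq count_predT iter_addr addr0.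
  rewrite -(ler_nat R) natrM -/x xE GE big_seq [leRHS]big_seq.
  by apply: ler_sum => s /wG/andP[].
have goodG : (n <= count (predC bad) G)%N.
  move: sizeG badG; rewrite -(count_predC bad G) mul2n -addnn => h1 h2.
  by rewrite -(leq_add2l n) (leq_trans h1)// leq_add2r.
pose F (v : borel R q) : \bar R := (dist_to v (range e) `^ r)%:E.
have mF : measurable_fun setT F by exact: dist_to_powR_measurable.
have F0 v : (0 <= F v)%E by rewrite lee_fin powR_ge0.
pose Phi s := ((word_prod t s)%:E * \int[nu]_v F (word_map g s v))%E.
have Phi0 s : (0 <= Phi s)%E.
  by rewrite mule_ge0 ?integral_ge0// lee_fin ltW// word_prod_gt0.
have -> : distortion nu r (range e) = Phi [::].
  by rewrite /Phi /word_prod big_nil mul1e.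
rewrite (addG Phi) => [|s]; last exact: self_similar_integral_word hg ht hnu mF F0.
pose K := ku * (wm / x) `^ (1 + rho).
have K0 : 0 < K by rewrite mulr_gt0 ?powR_gt0 ?divr_gt0.
have PhiK s : s \in G -> ((if predC bad s then K else 0)%:E <= Phi s)%E.
  move=> sG; case: ifPn => //=; rewrite negb_exists => /forallP good.
  apply: le_trans (self_similar_integral_word_le F s u hg ht hnu mF F0).
  apply: (@le_trans _ _ ((word_prod t (s ++ u))%:E * (cu s `^ r)%:E)%E).
    have cs0 := ltW (word_prod_gt0 c s c0); have cu_ge0 := ltW (word_prod_gt0 c u c0).
    rewrite -EFinM lee_fin /cu !word_prod_cat powRM//.
    rewrite mulrACA (word_prod_powR s c0 ht w0 hw) -/ku mulrC /K.
    rewrite ler_pM2l//; apply: ge0_ler_powR; rewrite ?nnegrE ?addr_ge0//.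
    - by rewrite divr_ge0 ?ltW.
    - by rewrite ltW ?word_prod_gt0.
    by rewrite ler_pdivrMr// mulrC; have /andP[] := wG s sG.
  apply: lee_wpmul2l; first by rewrite lee_fin ltW// word_prod_gt0.
  apply: (integral_ge_ball (cu s `^ r) rho0 y (fun v => F (word_map g (s ++ u) v))).
  - exact: powR_ge0.
  - apply: (measurableT_comp mF); apply: continuous_borel_measurable.
    exact: word_map_continuous hg.
  - by move=> v; exact: F0.
  - exact: ytail.
  move=> v yv; rewrite lee_fin; apply: ge0_ler_powR;
    rewrite ?nnegrE ?(ltW r0) ?(ltW (cu0 s)) ?dist_to_ge0//.
  apply: le_dist_to => // _ [j _ <-].
  have := good j; rewrite -leNgt => hj.
  have := eucl_dist_triangle (word_map g (s ++ u) v) (z s) (e j).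
  rewrite /z (word_map_dist _ _ _ hg) -/(cu s) => tri.
  have : cu s * eucl_dist y v <= cu s * rho0 by rewrite ler_pM2l.
  by move: hj tri; rewrite /z; lra.
apply: (@le_trans _ _ (\sum_(s <- G) (if predC bad s then K else 0)%:E)%E); last first.
  by rewrite big_seq [leRHS]big_seq; apply: lee_sum => s; exact: PhiK.
rewrite sumEFin lee_fin -big_mkcond big_const_seq iter_addr addr0.
apply: (@le_trans _ _ (K *+ n)); last by rewrite ler_pMn2l.
have nE : n%:R `^ (- (1 + rho)) *+ n = n%:R `^ (- rho) :> R.
  rewrite -mulr_natr -[X in _ * X]powRr1; last exact: ltW.
  rewrite -powRD; first by congr (_ `^ _); ring.
  by rewrite (gt_eqF n0) implybT.
have wmx : (wm / x) `^ (1 + rho) = (wm / 2) `^ (1 + rho) * n%:R `^ (- (1 + rho)).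
  have -> : wm / x = wm / 2 * n%:R `^ (-1).
    by rewrite powR_inv1 ?(ltW n0)// /x invfM mulrA.
  by rewrite powRM ?powR_ge0 ?divr_ge0 ?(ltW wm0)// -powRrM mulN1r.
by rewrite /K wmx mulrA -mulrnAr nE.
Qed.

(** * The exponent for small r *)

(** z^eta tends to 1 as eta tends to 0; explicitly, z^eta >= 1 + eta ln z. *)
Lemma exists_powR_gt {R : realType} (z u : R) : 0 < z -> u < 1 ->
  exists2 eta, 0 < eta < 1 & u < z `^ eta.
Proof.
move=> z0 u1; pose B := 1 + `|ln z|.
have B0 : 0 < B by rewrite ltr_pwDl.
pose m := Num.min 1 (1 - u).
have m0 : 0 < m by rewrite lt_min ltr01 subr_gt0.
have hm : m / (2 * B) * B = m / 2 by field; rewrite gt_eqF.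
have eta0 : 0 < m / (2 * B) by rewrite divr_gt0 ?mulr_gt0.
exists (m / (2 * B)).
  rewrite eta0 ltr_pdivrMr ?mulr_gt0// mul1r.
  apply: (@le_lt_trans _ _ 1); first by rewrite ge_min lexx.
  by rewrite (@lt_le_trans _ _ (2 * 1))//; [rewrite mulr1 ltr1n|rewrite ler_pM2l// lerDl].
rewrite /powR gt_eqF//; apply: lt_le_trans (expR_ge1Dx _).
have : - (m / (2 * B) * B) <= m / (2 * B) * ln z.
  rewrite -mulrN ler_pM2l//; have := ler_norm (- ln z); rewrite normrN /B; lra.
rewrite hm; have : m <= 1 - u by rewrite ge_min lexx orbT.
move: m0 u1; lra.
Qed.

Lemma sum_powR_lt1 {R : realType} {n : nat} (p : 'I_n -> R) :
  (forall i, 0 < p i) -> \sum_i p i < 1 ->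
  exists2 theta, 0 < theta < 1 & \sum_i p i `^ theta < 1.
Proof.
move=> p0 p1; have [m /andP[m0 m1] mp] := fin_pos_lbound p p0.
have [eta /andP[eta0 eta1] heta] := exists_powR_gt m (\sum_i p i) m0 p1.
exists (1 - eta); first by rewrite subr_gt0 eta1/= ltrBlDr ltrDl.
have me0 : 0 < m `^ eta by exact: powR_gt0.
apply: (@le_lt_trans _ _ (\sum_i p i * (m `^ eta)^-1)).
  apply: ler_sum => i _.
  rewrite powRD ?powRr1 ?(ltW (p0 i))//; last by rewrite (gt_eqF (p0 i)) implybT.
  rewrite powRN ler_pM2l// lef_pV2 ?posrE ?powR_gt0//.
  by apply: ge0_ler_powR; rewrite ?nnegrE ?(ltW eta0) ?(ltW m0) ?(ltW (p0 i)).
by rewrite -mulr_suml ltr_pdivrMr// mul1r.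
Qed.

Lemma lt1_of_sum1 {R : realType} {M : nat} (t : 'I_M -> R) i :
  (2 <= M)%N -> (forall i, 0 < t i) -> \sum_i t i = 1 -> t i < 1.
Proof.
move=> hM ht t1.
have M0 : (0 < M)%N by exact: ltn_trans hM.
have [j ji] : exists j : 'I_M, j != i.
  have [->|i0] := eqVneq i (Ordinal M0); first by exists (Ordinal hM).
  by exists (Ordinal M0); rewrite eq_sym.
rewrite -t1 (bigD1 i)//= (bigD1 j)//= ltrDl ltr_pwDl// sumr_ge0// => k _.
exact: ltW.
Qed.

(** Choose th0 < 1 such that the p_i^th0 still sum to less than 1. The t_i^th0 sum
    to more than 1, so for small r no theta <= th0 can solve the equation for
    theta: its left side would exceed 1. Hence theta > th0, which bounds the
    second sum. *)
Lemma small_order_exponent {R : realType} {M N : nat} {c t : 'I_M -> R}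
    {a p : 'I_N -> R} :
  (2 <= M)%N -> (forall i, 0 < c i < 1) -> (forall i, 0 < t i) -> \sum_i t i = 1 ->
  (forall i, 0 < a i < 1) -> (forall i, 0 < p i) -> \sum_i p i < 1 ->
  exists2 r0, 0 < r0 & forall r theta, 0 < r -> r < r0 -> 0 < theta < 1 ->
    \sum_i (t i * c i `^ r) `^ theta = 1 -> \sum_i (p i * a i `^ r) `^ theta < 1.
Proof.
move=> hM c01 t0 t1 a01 p0 p1.
have [th0 /andP[th00 th01] pth0] := sum_powR_lt1 p p0 p1.
have t_lt1 i : t i < 1 by exact: lt1_of_sum1.
have c0 i : 0 < c i by have /andP[] := c01 i.
have [cm /andP[cm0 cm1] cmc] := fin_pos_lbound c c0.
pose T := \sum_i t i `^ th0.
have T1 : 1 < T.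
  rewrite -t1 /T; apply: ltr_sum => [|i _].
    by apply/hasP; exists (Ordinal hM); rewrite ?mem_index_enum.
  rewrite -[ltLHS]powRr1 ?(ltW (t0 i))// /powR gt_eqF// ltr_expR.
  by rewrite ltr_nM2r// ln_lt0// t0/=.
have T0 : 0 < T by exact: lt_trans T1.
have Tinv : T^-1 < 1 by rewrite invf_lt1.
have [r0 /andP[r00 _] hr0] := exists_powR_gt cm T^-1 cm0 Tinv.
exists r0 => // r th r_gt0 rr0 /andP[th_gt0 th_lt1] sum1.
have th0th : th0 < th.
  rewrite ltNge; apply/negP => thth0; suff : 1 < 1 :> R by rewrite ltxx.
  rewrite -[X in _ < X]sum1; apply: (@lt_le_trans _ _ (T * cm `^ r0)).
    by rewrite mulrC -ltr_pdivrMr// mul1r.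
  rewrite /T mulr_suml; apply: ler_sum => i _.
  rewrite powRM ?powR_ge0 ?(ltW (t0 i))//; apply: ler_pM; rewrite ?powR_ge0//.
    by apply: ger_powR => //; rewrite t0 ltW.
  rewrite -powRrM; apply: (@le_trans _ _ (cm `^ (r * th))).
    apply: ger_powR; first by rewrite cm0.
    by rewrite -[leRHS]mulr1 ler_pM ?ltW.
  by apply: ge0_ler_powR; rewrite ?nnegrE ?mulr_ge0 ?(ltW r_gt0) ?(ltW th_gt0) ?(ltW cm0) ?(ltW (c0 i)).
apply: le_lt_trans pth0; apply: ler_sum => i _.
have /andP[a0 a1] := a01 i.
have p_le1 : p i <= 1.
  apply: le_trans (ltW p1); rewrite (bigD1 i)//= lerDl sumr_ge0// => j _.
  exact: ltW.
apply: (@le_trans _ _ (p i `^ th)); last by apply: ger_powR; rewrite ?p0 ?(ltW th0th).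
apply: ge0_ler_powR; rewrite ?nnegrE ?mulr_ge0 ?powR_ge0 ?(ltW th_gt0) ?(ltW (p0 i))//.
have one : 1 `^ r = 1 :> R by rewrite powR1.
rewrite ger_pMr// -[leRHS]one; apply: ge0_ler_powR;
  by rewrite ?nnegrE ?(ltW r_gt0) ?(ltW a0) ?(ltW a1).
Qed.

(** * Quantization error *)

Lemma card_set_seq_le {T : pointedType} (S : seq T) : ([set` S] #<= `I_(size S))%card.
Proof.
apply/pcard_surjP; exists (nth point S) => x /= xS.
by exists (index x S); rewrite /= ?index_mem// nth_index.
Qed.

(** Spend the budget n / C, which makes codebooks of at most n points. *)
Lemma quantization_error_upper {R : realType} {q : nat} {P : probability (borel R q) R}
    {r s : R} :
  0 < r -> 0 < s -> has_covers P r (r / s) ->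
  exists2 K, 0 < K & exists n0 : nat, forall n, (n0 <= n)%N ->
    (quantization_error P r n <= (K * n%:R `^ (- s^-1))%:E)%E.
Proof.
move=> r0 s0 [C [D [C0 D0 hP]]].
exists ((D * C^-1 `^ (- (r / s))) `^ r^-1).
  by rewrite powR_gt0// mulr_gt0// powR_gt0// invr_gt0.
exists (Num.truncn C).+1 => n Cn.
have Cn' : C <= n%:R by apply: le_trans (ltW (truncnS_gt C)) _; rewrite ler_nat.
have nC : 1 <= n%:R / C by rewrite ler_pdivlMr// mul1r.
have [S [S0 sS dS]] := hP _ nC; rewrite mulrCA divff ?gt_eqF// mulr1 ler_nat in sS.
apply: ereal_inf_le; exists (poweR (distortion P r [set` S]) r^-1).
  exists [set` S] => //; split; first exact: set_seq_neq0.
  by apply: card_le_trans (card_set_seq_le S) _; rewrite card_le_II.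
apply: (@le_trans _ _ (poweR (D * (n%:R / C) `^ (- (r / s)))%:E r^-1)).
  apply: gt0_ler_poweR => //; rewrite ?in_itv/= ?leey ?andbT.
  - by rewrite invr_ge0 ltW.
  - exact: distortion_ge0.
  - by rewrite lee_fin mulr_ge0 ?powR_ge0 ?(ltW D0).
rewrite lee_fin [(n%:R / C) `^ _]powRM ?invr_ge0 ?(ltW C0)//.
rewrite [_ `^ _ * _ `^ _]mulrC mulrA powRM ?mulr_ge0 ?powR_ge0 ?(ltW D0)// -powRrM.
by have -> : - (r / s) * r^-1 = - s^-1 by field; rewrite !gt_eqF.
Qed.

Lemma quantization_error_lower {R : realType} {q : nat} {P : probability (borel R q) R}
    {r s k : R} :
  0 < r -> 0 < s -> 0 < k ->
  (forall n (e : 'I_n.+1 -> 'rV[R]_q),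
    ((k * n.+1%:R `^ (- (r / s)))%:E <= distortion P r (range e))%E) ->
  forall n, (0 < n)%N ->
    ((k `^ r^-1 * n%:R `^ (- s^-1))%:E <= quantization_error P r n)%E.
Proof.
move=> r0 s0 k0 hk [//|n] _; apply: le_ereal_inf_tmp => _ [alpha [al0 alc] <-].
have /pcard_surjP[e esurj] := alc.
have kE : k `^ r^-1 * n.+1%:R `^ (- s^-1) = (k * n.+1%:R `^ (- (r / s))) `^ r^-1.
  rewrite powRM ?powR_ge0 ?(ltW k0)// -powRrM; congr (_ * _ `^ _).
  by field; rewrite !gt_eqF.
rewrite kE -[leLHS]/(poweR (k * n.+1%:R `^ (- (r / s)))%:E r^-1).
apply: gt0_ler_poweR; rewrite ?in_itv/= ?leey ?andbT.
- by rewrite invr_ge0 ltW.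
- by rewrite lee_fin mulr_ge0 ?powR_ge0 ?(ltW k0).
- exact: distortion_ge0.
apply: le_trans (hk n (fun i => e i)) _.
apply: ge0_le_integral => //.
- by move=> x _; rewrite lee_fin powR_ge0.
- by apply: dist_to_powR_measurable; exists (e 0%N), ord0.
- exact: dist_to_powR_measurable.
have sub : alpha `<=` range (fun i : 'I_n.+1 => e i).
  by move=> x /esurj[i /= ni <-]; exists (Ordinal ni).
move=> x _; rewrite lee_fin; apply: ge0_ler_powR;
  rewrite ?nnegrE ?(ltW r0) ?dist_to_ge0//.
- by exists (e 0%N), ord0.
- exact: dist_to_subset.
Qed.

(** * Dimension and coefficients from two-sided bounds *)

(** The bounds give |1 / s - (- ln e_n) / ln n| <= (|ln k| + |ln K|) / ln n; the
    reciprocal is then the quotient in the definition of the dimension. *)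
Lemma quantization_dimension_of_bounds {R : realType} {q : nat}
    {P : probability (borel R q) R} {r s k K : R} (n0 : nat) :
  0 < s -> 0 < k -> 0 < K ->
  (forall n, (n0 <= n)%N -> ((k * n%:R `^ (- s^-1))%:E <= quantization_error P r n)%E) ->
  (forall n, (n0 <= n)%N -> (quantization_error P r n <= (K * n%:R `^ (- s^-1))%:E)%E) ->
  is_quantization_dimension P r s.
Proof.
move=> s0 k0 K0 lo up; rewrite /is_quantization_dimension.
pose e n := fine (quantization_error P r n).
pose B := `|ln k| + `|ln K|.
have eB n : (n0 <= n)%N -> (1 < n)%N ->
    `|s^-1 - (- ln (e n)) / ln n%:R| <= B / ln n%:R.
  move=> n0n n1; have nr0 : 0 < n%:R :> R by rewrite ltr0n ltnW.
  have ln0 : 0 < ln n%:R :> R by rewrite ln_gt0// ltr1n.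
  have np : 0 < n%:R `^ (- s^-1) :> R by exact: powR_gt0.
  have := up n n0n; have := lo n n0n.
  rewrite /e; case: (quantization_error P r n) => [x| |]//=; rewrite !lee_fin => kx xK.
  have x0 : 0 < x by apply: lt_le_trans kx; exact: mulr_gt0.
  have : ln (k * n%:R `^ (- s^-1)) <= ln x.
    by rewrite ler_ln ?posrE ?mulr_gt0.
  have : ln x <= ln (K * n%:R `^ (- s^-1)).
    by rewrite ler_ln ?posrE ?mulr_gt0.
  rewrite !lnM ?posrE// !ln_powR => xK' kx'.
  have -> : s^-1 - - ln x / ln n%:R = (ln x + s^-1 * ln n%:R) / ln n%:R.
    by field; rewrite !gt_eqF.
  rewrite normrM [`|_^-1|]gtr0_norm ?invr_gt0// ler_wpM2r ?invr_ge0 ?(ltW ln0)//.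
  rewrite ler_norml /B; have := ler_norm (ln K); have := ler_norm (- ln k).
  have := normr_ge0 (ln K); have := normr_ge0 (ln k).
  rewrite normrN; move: xK' kx'; rewrite !mulNr => *.
  by apply/andP; split; lra.
have inv_cvg : (fun n : nat => (- ln (e n)) / ln n%:R) @ \oo --> s^-1.
  apply/cvgrPdist_le => eps eps0.
  pose n1 := (Num.truncn (expR (B / eps))).+1.
  exists (maxn n0 (maxn n1 2)) => // n /=.
  rewrite !geq_max => /and3P[n0n n1n n2].
  apply: le_trans (eB n n0n n2) _.
  have nr0 : 0 < n%:R :> R by rewrite ltr0n ltnW.
  have ln0 : 0 < ln n%:R :> R by rewrite ln_gt0// ltr1n.
  rewrite ler_pdivrMr// mulrC -ler_pdivrMr//.
  rewrite -[leLHS]expRK ler_ln ?posrE ?expR_gt0//.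
  by apply: le_trans (ltW (truncnS_gt _)) _; rewrite ler_nat.
have -> : (fun n : nat => ln n%:R / - ln (e n)) =
    (fun n : nat => ((- ln (e n)) / ln n%:R)^-1).
  by apply/funext => n; rewrite invf_div.
rewrite -[X in _ --> X](invrK s); apply: cvgV => //.
by rewrite invr_neq0// gt_eqF.
Qed.

Lemma limn_esup_le_bound {R : realType} (u : nat -> \bar R) (x : \bar R) (n0 : nat) :
  (forall n, (n0 <= n)%N -> (u n <= x)%E) -> (limn_esup u <= x)%E.
Proof.
move=> ux; apply: ereal_inf_le.
exists (ereal_sup [set u n | n in [set n | (n0 <= n)%N]]).
  by exists [set n | (n0 <= n)%N] => //; exists n0.
by apply: ge_ereal_sup => _ [n /ux un <-].
Qed.

Lemma lower_coef_gt0_of_bound {R : realType} {q : nat}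
    {P : probability (borel R q) R} {r s k : R} (n0 : nat) :
  0 < k -> (0 < n0)%N ->
  (forall n, (n0 <= n)%N -> ((k * n%:R `^ (- s^-1))%:E <= quantization_error P r n)%E) ->
  (0 < lower_quantization_coef P r s)%E.
Proof.
move=> k0 n00 lo; apply: (@lt_le_trans _ _ k%:E); first by rewrite lte_fin.
rewrite /lower_quantization_coef /limn_einf leeNr.
apply: (limn_esup_le_bound _ _ n0) => n n0n; rewrite leeN2.
have nr0 : 0 < n%:R :> R by rewrite ltr0n (leq_trans n00).
have np : 0 < n%:R `^ s^-1 :> R by exact: powR_gt0.
have -> : k%:E = ((n%:R `^ s^-1)%:E * (k * n%:R `^ (- s^-1))%:E)%E.
  by rewrite -EFinM powRN; congr EFin; field; rewrite gt_eqF.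
by apply: lee_wpmul2l; [rewrite lee_fin ltW|exact: lo].
Qed.

Lemma upper_coef_lty_of_bound {R : realType} {q : nat}
    {P : probability (borel R q) R} {r s K : R} (n0 : nat) :
  (0 < n0)%N ->
  (forall n, (n0 <= n)%N -> (quantization_error P r n <= (K * n%:R `^ (- s^-1))%:E)%E) ->
  (upper_quantization_coef P r s < +oo)%E.
Proof.
move=> n00 up; apply: (@le_lt_trans _ _ K%:E); last by rewrite ltry.
apply: (limn_esup_le_bound _ _ n0) => n n0n.
have nr0 : 0 < n%:R :> R by rewrite ltr0n (leq_trans n00).
have np : 0 < n%:R `^ s^-1 :> R by exact: powR_gt0.
have -> : K%:E = ((n%:R `^ s^-1)%:E * (K * n%:R `^ (- s^-1))%:E)%E.
  by rewrite -EFinM powRN; congr EFin; field; rewrite gt_eqF.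
by apply: lee_wpmul2l; [rewrite lee_fin ltW|exact: up].
Qed.

Theorem corollary1p3 (R : realType) (q M N : nat)
    (hq : (1 <= q)%N) (hM : (2 <= M)%N) (hN : (2 <= N)%N)
    (g : 'I_M -> 'rV[R]_q -> 'rV[R]_q) (c t : 'I_M -> R)
    (hg : forall i, contractive_similitude (c i) (g i))
    (hgO : open_set_condition g)
    (ht : forall i, 0 < t i) (ht1 : \sum_(i < M) t i = 1)
    (nu : probability (borel R q) R)
    (hnu : self_similar_measure g t nu)
    (f : 'I_N -> 'rV[R]_q -> 'rV[R]_q) (a : 'I_N -> R) (p : 'I_N.+1 -> R)
    (hf : forall i, contractive_similitude (a i) (f i))
    (hp : forall i, 0 < p i) (hp1 : \sum_(i < N.+1) p i = 1)
    (E : set 'rV[R]_q) (hE : self_similar_set f E)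
    (hI : in_homogeneous_osc f E nu)
    (mu : probability (borel R q) R)
    (hmu : condensation_measure f p nu mu)
    (s : R -> R)
    (hs : forall r : R, 0 < r ->
      0 < s r /\ \sum_(i < M) (t i * c i `^ r) `^ (s r / (s r + r)) = 1) :
  exists r0 : R, 0 < r0 /\
    forall r : R, 0 < r -> r < r0 ->
      [/\ is_quantization_dimension mu r (s r),
          is_quantization_dimension nu r (s r),
          (0 < lower_quantization_coef mu r (s r))%E,
          (lower_quantization_coef mu r (s r)
             <= upper_quantization_coef mu r (s r))%E
        & (upper_quantization_coef mu r (s r) < +oo)%E].
Proof.
have c01 i : 0 < c i < 1 by have [] := hg i.
have a01 i : 0 < a i < 1 by have [] := hf i.
have c0 i : 0 < c i by have /andP[] := c01 i.
have a0 i : 0 < a i by have /andP[] := a01 i.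
pose p' i := p (lift ord0 i).
have p'0 i : 0 < p' i by exact: hp.
have p'1 : \sum_i p' i < 1.
  by rewrite -hp1 big_ord_recl/= ltrDr; exact: hp.
have [r0 r00 hr0] := small_order_exponent hM c01 ht ht1 a01 p'0 p'1.
have [V hO] := hgO; have [_ [y Oy] _ _ _] := hO.
have [rn rn0 nutail] : exists2 rn, 0 < rn & nu (eucl_tail y rn) = 0%E.
  apply: (bounded_support 0 hg) => [i||rho _]; first exact: ltW (ht i).
    by rewrite ht1.
  by rewrite (hnu _ (eucl_tail_measurable y rho)).
have [rm rm0 mutail] : exists2 rm, 0 < rm & mu (eucl_tail y rm) = 0%E.
  apply: (bounded_support rn hf) => [i||rho rnrho]; first exact: ltW (p'0 i).
    exact: ltW.
  rewrite (hmu _ (eucl_tail_measurable y rho)).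
  suff -> : nu (eucl_tail y rho) = 0%E by rewrite mule0 add0e.
  apply/eqP; rewrite eq_le measure_ge0 andbT -nutail.
  apply: le_measure; rewrite ?inE; last exact: eucl_tail_subset.
  - exact: eucl_tail_measurable.
  - exact: eucl_tail_measurable.
exists r0; split=> // r r_gt0 rr0.
have [sr0 hsr] := hs r r_gt0.
set th := s r / (s r + r) in hsr; set rho := r / s r.
have th01 : 0 < th < 1.
  by rewrite divr_gt0 ?addr_gt0//= ltr_pdivrMr ?addr_gt0// mul1r ltrDl.
have /andP[th0 _] := th01.
have rho_ge0 : 0 <= rho by rewrite divr_ge0 ?ltW.
have thrho : th * (1 + rho) = 1.
  by rewrite /th /rho; field; rewrite !gt_eqF ?addr_gt0.
have hv1 := hr0 r th r_gt0 rr0 th01 hsr.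
pose w i := (t i * c i `^ r) `^ th; pose v i := (p' i * a i `^ r) `^ th.
have hw i : t i * c i `^ r = w i `^ (1 + rho).
  by rewrite /w -powRrM thrho powRr1// mulr_ge0 ?powR_ge0 ?(ltW (ht i)).
have hv i : p' i * a i `^ r = v i `^ (1 + rho).
  by rewrite /v -powRrM thrho powRr1// mulr_ge0 ?powR_ge0 ?(ltW (p'0 i)).
have w_gt0 i : 0 < w i by rewrite powR_gt0// mulr_gt0// powR_gt0.
have v0 i : 0 < v i by rewrite powR_gt0// mulr_gt0// powR_gt0.
have w01 i : 0 < w i < 1 by rewrite w_gt0 (lt1_of_sum1 w i hM w_gt0 hsr).
have v01 i : 0 < v i < 1.
  rewrite v0 (le_lt_trans _ hv1)// (bigD1 i)//= lerDl sumr_ge0// => j _.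
  exact: powR_ge0.
have nucov : has_covers nu r rho.
  exact: (self_similar_covers (ltnW hM) hg ht hnu r_gt0 rho_ge0 w01 hsr hw rn0 nutail).
have mucov : has_covers mu r rho.
  exact: (condensation_covers hf hp hmu r_gt0 rho_ge0 v01 hv1 hv rm0 mutail nucov).
have [k k0 nulow] :=
  self_similar_distortion_lower hg hO Oy ht hnu r_gt0 rho_ge0 w01 hsr hw rn0 nutail.
have mulow n (e : 'I_n.+1 -> 'rV[R]_q) :
    ((p ord0 * k * n.+1%:R `^ (- rho))%:E <= distortion mu r (range e))%E.
  have e0 : range e !=set0 by exists (e ord0), ord0.
  rewrite (condensation_distortion r _ hf hp hmu e0) -mulrA EFinM.
  apply: (@le_trans _ _ ((p ord0)%:E * distortion nu r (range e))%E).
    by apply: lee_wpmul2l; [rewrite lee_fin ltW|exact: nulow].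
  rewrite leeDl// sume_ge0// => i _; rewrite mule_ge0 ?lee_fin ?(ltW (p'0 i))//.
  by apply: integral_ge0 => x _; rewrite lee_fin powR_ge0.
have pk0 : 0 < p ord0 * k by exact: mulr_gt0.
have nuL := quantization_error_lower r_gt0 sr0 k0 nulow.
have muL := quantization_error_lower r_gt0 sr0 pk0 mulow.
have [Kn Kn0 [nn nuU]] := quantization_error_upper r_gt0 sr0 nucov.
have [Km Km0 [nm muU]] := quantization_error_upper r_gt0 sr0 mucov.
have muU' n : (nm.+1 <= n)%N ->
  (quantization_error mu r n <= (Km * n%:R `^ (- (s r)^-1))%:E)%E.
  by move=> /ltnW; exact: muU.
have nuU' n : (nn.+1 <= n)%N ->
  (quantization_error nu r n <= (Kn * n%:R `^ (- (s r)^-1))%:E)%E.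
  by move=> /ltnW; exact: nuU.
have muL' n : (nm.+1 <= n)%N ->
  (((p ord0 * k) `^ r^-1 * n%:R `^ (- (s r)^-1))%:E <= quantization_error mu r n)%E.
  by move=> nmn; apply: muL; exact: leq_ltn_trans nmn.
have nuL' n : (nn.+1 <= n)%N ->
  ((k `^ r^-1 * n%:R `^ (- (s r)^-1))%:E <= quantization_error nu r n)%E.
  by move=> nmn; apply: nuL; exact: leq_ltn_trans nmn.
split.
- exact: (quantization_dimension_of_bounds nm.+1 sr0 (powR_gt0 _ pk0) Km0 muL' muU').
- exact: (quantization_dimension_of_bounds nn.+1 sr0 (powR_gt0 _ k0) Kn0 nuL' nuU').
- exact: (lower_coef_gt0_of_bound nm.+1 (powR_gt0 _ pk0) (ltn0Sn _) muL').
- exact: limn_einf_sup.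
- exact: (upper_coef_lty_of_bound nm.+1 (ltn0Sn _) muU').
Qed.
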